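(* Let $n$ be a positive integer. If $n$ is odd, then the set of characteristic supercharacter theories of $D_{2n}$ can be expressed as the disjoint union \[ \mathrm{CharSCT}(D_{2n}) = \bigsqcup_{d\mid n}\mathcal{P}_d . \] If $n$ is even, then for any $T\in\mathcal{Q}$ we may produce a new supercharacter theory $\psi(T)\in\mathrm{CharSCT}(D_{2n})$ by splitting the two conjugacy classes of reflections $s\langle r^2\rangle$ and $sr\langle r^2\rangle$ into distinct superclasses, and $\mathrm{CharSCT}(D_{2n})$ can be expressed as the disjoint union \[ \mathrm{CharSCT}(D_{2n}) = \Big(\bigsqcup_{d\mid n}\mathcal{P}_d\Big)\sqcup\psi(\mathcal{Q}). \] Here $d$ ranges over the positive divisors of $n$.
   Context: Supercharacter theories. A supercharacter theory of a finite group $G$ is a pair $S=(\mathcal{K},\mathcal{X})$, where $\mathcal{K}$ is a partition of $G$ into unions of conjugacy classes and $\mathcal{X}$ is a partition of $\mathrm{Irr}(G)$ (complex irreducible characters), such that $|\mathcal{K}|=|\mathcal{X}|$, $\{e\}\in\mathcal{K}$, and for each $X\in\mathcal{X}$ the character $\sigma_X=\sum_{\chi\in X}\chi(e)\chi$ is constant on each part of $\mathcal{K}$. The parts of $\mathcal{K}$ are the superclasses of $S$. $\mathrm{SCT}(G)$ is the set of supercharacter theories of $G$, partially ordered by $(\mathcal{K},\mathcal{X})\le(\mathcal{L},\mathcal{Y})$ if $\mathcal{K}$ refines $\mathcal{L}$ (equivalently, $\mathcal{X}$ refines $\mathcal{Y}$); $\mathcal{K}$ and $\mathcal{X}$ determine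 each other, and $\mathrm{SCT}(G)$ is a lattice. $M(G)$ denotes the supercharacter theory with superclasses $\{e\}$ and $G\setminus\{e\}$ (the nonempty ones) and supercharacter parts $\{\mathbf{1}_G\}$ and $\mathrm{Irr}(G)\setminus\{\mathbf{1}_G\}$ (the nonempty ones), where $\mathbf{1}_G$ is the trivial character. Characteristic theories. For $\alpha\in\mathrm{Aut}(G)$ and $S=(\mathcal{K},\mathcal{X})$, let $\alpha\cdot S=(\alpha\cdot\mathcal{K},\alpha\cdot\mathcal{X})$ with $\alpha\cdot\mathcal{K}=\{\alpha(K):K\in\mathcal{K}\}$ and $\alpha\cdot\mathcal{X}=\{\{\chi\circ\alpha^{-1}:\chi\in X\}:X\in\mathcal{X}\}$. $S$ is characteristic if $\alpha\cdot S=S$ for all $\alpha\in\mathrm{Aut}(G)$; $\mathrm{CharSCT}(G)$ is the set of these. $\ast$-product. Let $N\lhd G$. A supercharacter theory of $N$ is $G$-invariant if each of its superclasses is a union of $G$-conjugacy classes; $m_G(N)$ is the one whose superclasses are exactly the $G$-conjugacy classes contained in $N$ (and whose supercharacter parts are the $G$-orbits on $\mathrm{Irr}(N)$). If $S=(\mathcal{K},\mathcal{X})$ is a $G$-invariant supercharacter theory of $N$ and $T=(\mathcal{L},\mathcal{Y})\in\mathrm{SCT}(G/N)$, then $S\ast_N T$ is the supercharacter theory of $G$ with superclass partition $\mathcal{K}\cup\{\bigcup_{gN\in L}gN: L\in\mathcal{L},\ L\ne\{eN\}\}$ and supercharacter partition $\mathcal{Y}\cup\{X^G:X\in\mathcal{X},\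 X\neq\{\mathbf{1}_N\}\}$, where $X^G$ is the set of irreducible characters of $G$ lying over some element of $X$ and $\mathrm{Irr}(G/N)$ is identified with a subset of $\mathrm{Irr}(G)$ by inflation. Dihedral groups. $D_{2n}=\langle r,s: r^n=s^2=e,\ srs=r^{-1}\rangle$, of order $2n$. For each positive divisor $d$ of $n$ put \[ F_d=m_{D_{2n}}(\langle r^d\rangle)\ast_{\langle r^d\rangle}M(D_{2n}/\langle r^d\rangle),\qquad C_d=M(\langle r^d\rangle)\ast_{\langle r^d\rangle}M(D_{2n}/\langle r^d\rangle), \] and let $\mathcal{P}_d=[F_d,C_d]=\{S\in\mathrm{SCT}(D_{2n}):F_d\le S\le C_d\}$. For $n$ even, $\mu_0,\mu_1$ are the linear characters of $D_{2n}$ with $\mu_i(r^k)=(-1)^k$, $\mu_0(sr^k)=(-1)^k$, $\mu_1(sr^k)=-(-1)^k$, and $\chi_{n/2}:=\mu_0+\mu_1$. $\mathcal{Q}$ is the set of those $T=(\mathcal{L},\mathcal{Y})\in\mathcal{P}_1$ for which $\chi_{n/2}$ is a supercharacter, i.e. $\{\mu_0,\mu_1\}\in\mathcal{Y}$. (Every element of $\mathcal{P}_1$ has $s\langle r\rangle$ as a superclass.) For $T=(\mathcal{L},\mathcal{Y})\in\mathcal{Q}$, $\psi(T)$ is the pair with superclass partition $(\mathcal{L}\setminus\{s\langle r\rangle\})\cup\{s\langle r^2\rangle,\,sr\langle r^2\rangle\}$ and supercharacter partition $(\mathcal{Y}\setminus\{\{\mu_0,\mu_1\}\})\cup\{\{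\mu_0\},\{\mu_1\}\}$.
   Formalization: For even n the displayed equality is stated only for n ≠ 2: for n = 2 the group is the Klein four-group and the theory in P_1 with superclasses {e}, {r}, {s, sr} is not characteristic, so the equality fails; the other claims are kept for n = 2. *)

(* Defs.v *)
From mathcomp Require Import all_boot all_order all_fingroup all_algebra.
From mathcomp Require Import all_solvable all_field all_character.

Set Implicit Arguments.
Unset Strict Implicit.
Unset Printing Implicit Defensive.

Import GroupScope GRing.Theory.
Local Open Scope ring_scope.

(* Irr(G) is represented by its index type Iirr G, via i |-> 'chi_i; in        *)
(* particular (0 : Iirr G) is the index of the trivial character.             *)

Section Supercharacters.

Variable gT : finGroupType.
Implicit Types (G N : {group gT}).

(* Pairs (K, X) of a set of subsets of the group and a set of subsets of      *)
(* Irr(G); supercharacter theories are those satisfying is_sct.               *)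
Definition sct_pair G : Type := ({set {set gT}} * {set {set Iirr G}})%type.

Definition superclasses G (S : sct_pair G) : {set {set gT}} := S.1.
Definition superchar_parts G (S : sct_pair G) : {set {set Iirr G}} := S.2.

Definition sigma_char G (X : {set Iirr G}) : 'CF(G) :=
  \sum_(i in X) 'chi_i 1%g *: 'chi_i.

Definition is_sct G (S : sct_pair G) : bool :=
  [&& partition (superclasses S) G,
      [forall K in superclasses S, forall x in K, x ^: G \subset K],
      partition (superchar_parts S) [set: Iirr G],
      #|superclasses S| == #|superchar_parts S|,
      [set 1%g] \in superclasses S
    & [forall X in superchar_parts S, forall K in superclasses S,
         forall x in K, forall y in K, sigma_char X x == sigma_char X y]].

Definition SCT G : {set sct_pair G} := [set S | is_sct S].

Definition refines (T : finType) (P Q : {set {set T}}) : bool :=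
  [forall A in P, exists B in Q, A \subset B].

Definition sct_le G (S T : sct_pair G) : bool :=
  refines (superclasses S) (superclasses T).

Definition sct_interval G (S1 S2 : sct_pair G) : {set sct_pair G} :=
  [set S in SCT G | sct_le S1 S && sct_le S S2].

(* The theory M(G); removing set0 discards the second part when G is trivial. *)
Definition sctM G : sct_pair G :=
  ([set [set 1%g]; (G^#)%g] :\ set0, [set [set 0]; [set~ 0]] :\ set0).

(* The set {chi \o a^-1 | i in X, chi = 'chi_i} inside Irr(G), for a in Aut G. *)
Definition aut_act_irr G (a : {perm gT}) (X : {set Iirr G}) : {set Iirr G} :=
  [set j | [exists i in X, [forall x in G, 'chi_j x == 'chi_i (a^-1%g x)]]].

Definition aut_act G (a : {perm gT}) (S : sct_pair G) : sct_pair G :=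
  ([set a @: K | K : {set gT} in superclasses S],
   [set aut_act_irr a X | X in superchar_parts S]).

Definition CharSCT G : {set sct_pair G} :=
  [set S in SCT G | [forall a in Aut G, aut_act a S == S]].

(* The theory m_G(N), for N <| G: G-classes contained in N, G-orbits on Irr(N). *)
Definition sctm G N : sct_pair N :=
  ([set (x ^: G)%g | x in N],
   [set [set conjg_Iirr i y | y in G] | i : Iirr N]).

(* The irreducible characters of G lying over some element of X. *)
Definition lying_over G N (X : {set Iirr N}) : {set Iirr G} :=
  [set i | [exists j in X, j \in irr_constt ('Res[N] 'chi_i)]].

End Supercharacters.

Section StarProduct.

Variables (gT : finGroupType) (G N : {group gT}).

(* The product S *_N T; it is a supercharacter theory when N <| G, S is a     *)
(* G-invariant supercharacter theory of N, and T is one of G / N.             *)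
Definition sct_star (S : sct_pair N) (T : sct_pair (G / N)) : sct_pair G :=
  (superclasses S :|:
     [set \bigcup_(gN in L) (gN : {set gT})
        | L : {set coset_of N} in superclasses T :\ [set 1%g]],
   [set @mod_Iirr gT G N @: Y | Y : {set Iirr (G / N)} in superchar_parts T]
     :|: [set lying_over G X | X in superchar_parts S :\ [set 0]]).

End StarProduct.

Section Dihedral.

Variables (gT : finGroupType) (G : {group gT}) (r s : gT).

(* G = D_2n with distinguished generators r and s: the order condition makes  *)
(* the relations a presentation of G.                                         *)
Definition is_dihedral (n : nat) : Prop :=
  [/\ G :=: <<[set r; s]>>%g, #|G| = (2 * n)%N,
      (r ^+ n)%g = 1%g, (s ^+ 2)%g = 1%g & (s * r * s)%g = (r^-1)%g].

Definition sctF (d : nat) : sct_pair G :=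
  sct_star (sctm G <[r ^+ d]>) (sctM (G / <[r ^+ d]>)).

Definition sctC (d : nat) : sct_pair G :=
  sct_star (sctM <[r ^+ d]>) (sctM (G / <[r ^+ d]>)).

Definition sctP (d : nat) : {set sct_pair G} := sct_interval (sctF d) (sctC d).

(* mu_0 = mu_Iirr n false and mu_1 = mu_Iirr n true. For n even such a linear *)
(* character exists and is unique, so that the default value is never used.   *)
Definition mu_Iirr (n : nat) (b : bool) : Iirr G :=
  odflt 0 [pick i : Iirr G | ('chi_i \is a linear_char) &&
    [forall k : 'I_n, ('chi_i (r ^+ k)%g == (-1) ^+ k) &&
                      ('chi_i (s * r ^+ k)%g == (-1) ^+ b * (-1) ^+ k)]].

Definition sctQ (n : nat) : {set sct_pair G} :=
  [set T in sctP 1 |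
     [set mu_Iirr n false; mu_Iirr n true] \in superchar_parts T].

Definition psi (n : nat) (T : sct_pair G) : sct_pair G :=
  ((superclasses T :\ (s *: <[r]>)%g)
     :|: [set (s *: <[r ^+ 2]>)%g; ((s * r) *: <[r ^+ 2]>)%g],
   (superchar_parts T :\ [set mu_Iirr n false; mu_Iirr n true])
     :|: [set [set mu_Iirr n false]; [set mu_Iirr n true]]).

End Dihedral.

(* Main.v *)
(** The superclass functions of a supercharacter theory S = (K, X) form the span
of the sigma_X, because |K| = |X|; hence they are closed under convolution, K
determines X, and two elements lie in the same superclass exactly when all
sigma_X agree on them.

Membership of S in P_d amounts to G \ <r^d> being a superclass.  An automorphism
of D_2n (n <> 2) acts on <r> as a power map prime to n, hence through a Galois
automorphism on the values of the sigma_X, so it permutes the superclasses inside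
<r>; this makes the theories of P_d and psi(Q) characteristic.

Conversely, let S be characteristic and K the superclass of s.  If sr is in K,
then K contains all reflections, and squaring the class sum of K shows that
<r> \ K is a subgroup <r^d>.  Otherwise the automorphism r |-> r, s |-> sr moves K
to a disjoint superclass with the same rotations, so K = s<r^2>; then mu_0 - mu_1
is a superclass function, {mu_0} and {mu_1} are parts, and merging both pairs
gives an element of Q whose image under psi is S. *)
Require Import Defs.
From mathcomp Require Import all_boot all_order all_fingroup all_algebra.
From mathcomp Require Import all_solvable all_field all_character.

Set Implicit Arguments.
Unset Strict Implicit.
Unset Printing Implicit Defensive.

Import GroupScope GRing.Theory.

(** * Set partitions: images of blocks, splitting one block, merging two *)

Section Partitions.

Variable T : finType.
Implicit Types (P : {set {set T}}) (A B D : {set T}).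

Lemma pblock_partition P D x : partition P D -> x \in D ->
  (pblock P x \in P) /\ (x \in pblock P x).
Proof.
by case/and3P=> /eqP <- _ _ Dx; rewrite pblock_mem // mem_pblock.
Qed.

Lemma pblock_partition_eq P D B x :
  partition P D -> B \in P -> x \in B -> pblock P x = B.
Proof. by case/and3P=> _ tiP _; apply: def_pblock. Qed.

Lemma partition_block_sub P D B : partition P D -> B \in P -> B \subset D.
Proof. by case/and3P=> /eqP <- _ _ PB; apply: bigcup_sup. Qed.

Lemma partition_block_neq0 P D B : partition P D -> B \in P -> exists x, x \in B.
Proof. by case/and3P=> _ _ nP0 PB; apply/set0Pn; apply: contraNneq nP0 => <-. Qed.

Lemma partition_block_eq P D A B x : partition P D -> A \in P -> B \in P ->
  x \in A -> x \in B -> A = B.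
Proof.
move=> partP PA PB Ax Bx.
by rewrite -(pblock_partition_eq partP PA Ax) (pblock_partition_eq partP PB Bx).
Qed.

Lemma pblock_sym P D x y : partition P D -> x \in D -> y \in D ->
  (y \in pblock P x) = (x \in pblock P y).
Proof.
case/and3P=> /eqP <- tiP _ Dx Dy; rewrite -!eq_pblock //; exact: eq_sym.
Qed.

(** A map that preserves and reflects the relation of sharing a block carries the block of [x] onto
    the block of [h x]; as [h] maps [D] onto itself, every block is reached. This serves both for
    superclasses and for parts of Irr(G). *)
Lemma imset_partition_id (h : T -> T) P D :
    partition P D -> {in D &, injective h} -> h @: D = D ->
    {in D &, forall x y, (h y \in pblock P (h x)) = (y \in pblock P x)} ->
  [set h @: B | B : {set T} in P] = P.
Proof.
move=> partP injh hD hP.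
have imP x : x \in D -> h @: pblock P x = pblock P (h x).
  move=> Dx; have Dhx: h x \in D by rewrite -hD imset_f.
  have [PB Bx] := pblock_partition partP Dx.
  have [PB' Bhx] := pblock_partition partP Dhx.
  apply/setP=> z; apply/imsetP/idP=> [[y By ->] | Bz].
    by rewrite hP // (subsetP (partition_block_sub partP PB)).
  have: z \in h @: D by rewrite hD (subsetP (partition_block_sub partP PB')).
  by case/imsetP=> y Dy def_z; exists y; rewrite // -hP // -def_z.
apply/setP=> B; apply/imsetP/idP=> [[A PA ->] | PB].
  have [x Ax] := partition_block_neq0 partP PA.
  have Dx := subsetP (partition_block_sub partP PA) x Ax.
  rewrite -(pblock_partition_eq partP PA Ax) imP //.
  by case: (pblock_partition partP (_ : h x \in D)); rewrite // -hD imset_f.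
have [y By] := partition_block_neq0 partP PB.
have: y \in h @: D by rewrite hD (subsetP (partition_block_sub partP PB)).
case/imsetP=> x Dx def_y; exists (pblock P x).
  by case: (pblock_partition partP Dx).
by rewrite imP // -def_y (pblock_partition_eq partP PB By).
Qed.

(** The count is what keeps the numbers of superclasses and of parts equal when [psi] splits one
    block on each side. *)
Lemma partition_split P D A B : partition P D -> A :|: B \in P ->
    A != set0 -> B != set0 -> [disjoint A & B] ->
  partition ((P :\ (A :|: B)) :|: [set A; B]) D
  /\ #|(P :\ (A :|: B)) :|: [set A; B]| = #|P|.+1.
Proof.
move=> partP PAB nzA nzB tiAB.
have partP' := partitionD1 partP PAB.
have sABD := partition_block_sub partP PAB.
have tiB: [disjoint B & D :\: (A :|: B)].
  by apply/pred0P=> x; rewrite !inE /=; case: (x \in B); rewrite ?orbT.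
have partB := partitionU1 partP' nzB tiB.
have tiA: [disjoint A & B :|: D :\: (A :|: B)].
  apply/pred0P=> x; have /= := pred0P tiAB x; rewrite !inE.
  by case: (x \in A); case: (x \in B).
have partA := partitionU1 partB nzA tiA.
have defD: A :|: (B :|: D :\: (A :|: B)) = D.
  rewrite setUA; apply/setP=> x; move/subsetP/(_ x): sABD; rewrite !inE.
  by case: (x \in A); case: (x \in B) => //= ->.
have defP: A |: (B |: P :\ (A :|: B)) = (P :\ (A :|: B)) :|: [set A; B].
  by rewrite setUA setUC.
rewrite -defP; rewrite defD in partA; split=> //.
have notin Q (E F : {set T}) : partition Q E -> F != set0 -> [disjoint F & E] -> F \notin Q.
  move=> partQ /set0Pn[x Fx] tiF; apply/negP=> QF.
  have Ex := subsetP (partition_block_sub partQ QF) x Fx.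
  by move/pred0P/(_ x): tiF; rewrite /= Fx Ex.
rewrite cardsU1 (notin _ _ _ partB) // cardsU1 (notin _ _ _ partP') //.
by rewrite (cardsD1 (A :|: B) P) PAB.
Qed.

Lemma partition_merge P D A B : partition P D -> A \in P -> B \in P -> A != B ->
  partition ((A :|: B) |: P :\: [set A; B]) D
  /\ #|P| = #|(A :|: B) |: P :\: [set A; B]|.+1.
Proof.
move=> partP PA PB neqAB.
have PB': B \in P :\ A by rewrite !inE eq_sym neqAB.
have partP' := partitionD1 (partitionD1 partP PA) PB'.
have defP': P :\ A :\ B = P :\: [set A; B] by rewrite setDDl.
have defD': D :\: A :\: B = D :\: (A :|: B) by rewrite setDDl.
rewrite defP' defD' in partP'.
have nzAB: A :|: B != set0.
  have [x Ax] := partition_block_neq0 partP PA.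
  by apply/set0Pn; exists x; rewrite inE Ax.
have tiAB: [disjoint A :|: B & D :\: (A :|: B)].
  by rewrite -setI_eq0 setDE setICA setICr setI0.
have := partitionU1 partP' nzAB tiAB.
have -> : A :|: B :|: D :\: (A :|: B) = D.
  apply/setP=> x; rewrite !inE; case Ax: (x \in A) => /=.
    by rewrite (subsetP (partition_block_sub partP PA)).
  by case Bx: (x \in B); rewrite //= (subsetP (partition_block_sub partP PB)).
split=> //; rewrite cardsU1.
have -> /=: A :|: B \notin P :\: [set A; B].
  apply/negP=> PAB; have [x ABx] := set0Pn _ nzAB.
  have:= subsetP (partition_block_sub partP' PAB) x ABx.
  by rewrite in_setD ABx.
by rewrite (cardsD1 A P) PA (cardsD1 B (P :\ A)) PB' defP'.
Qed.

Lemma partition_merge_notin P D A B : partition P D -> A \in P -> B \in P ->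
  A != B -> A :|: B \notin P.
Proof.
move=> partP PA PB; apply: contra => PAB; apply/eqP.
have [x Ax] := partition_block_neq0 partP PA.
have [y By] := partition_block_neq0 partP PB.
apply: etrans (partition_block_eq partP PA PAB Ax _) _; rewrite ?inE ?Ax //.
by apply/esym/(partition_block_eq partP PB PAB By); rewrite inE By orbT.
Qed.

(** Used on both components to see that [psi] undoes a merging. *)
Lemma partition_mergeK P D A B : partition P D -> A \in P -> B \in P -> A != B ->
  ((A :|: B) |: P :\: [set A; B]) :\ (A :|: B) :|: [set A; B] = P.
Proof.
move=> partP PA PB neqAB; have nPAB := partition_merge_notin partP PA PB neqAB.
rewrite setU1K; last by rewrite inE (negPf nPAB) andbF.
apply/setP=> C; rewrite !inE; case: eqP => [-> | _]; first by rewrite orbT PA.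
by case: eqP => [-> | _]; rewrite ?orbT ?orbF.
Qed.

End Partitions.

(** * Superclass functions, and how the two partitions determine each other *)

Section SupercharacterTheory.

Variables (gT : finGroupType) (G : {group gT}).
Implicit Types (S : sct_pair G) (f g : 'CF(G)) (X : {set Iirr G}).

Local Open Scope ring_scope.

(** These are the superclass functions of [S]. *)
Definition block_fun S f : Prop :=
  forall K, K \in S.1 -> {in K &, forall x y, f x = f y}.

Variant sct_spec S : Prop := SctSpec of
    partition S.1 G
  & (forall K, K \in S.1 -> forall x, x \in K -> x ^: G \subset K)
  & partition S.2 [set: Iirr G]
  & #|S.1| = #|S.2|
  & [set 1%g] \in S.1
  & (forall X, X \in S.2 -> block_fun S (sigma_char X)).

Lemma is_sctP S : reflect (sct_spec S) (is_sct S).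
Proof.
apply: (iffP and5P) => [|[partK clK partX cardKX K1 sigK]].
  case=> partK /forall_inP clK partX /eqP cardKX /andP[K1 /forall_inP sigK].
  split=> // [K /clK/forall_inP // | X /sigK/forall_inP sigX K].
  move=> /sigX/forall_inP KX x y Kx Ky.
  by apply/eqP; move: y Ky; apply/forall_inP/KX.
split=> //; first by apply/forall_inP=> K /clK clKx; apply/forall_inP.
  exact/eqP.
rewrite [_ \in _]K1; apply/forall_inP=> X SX; apply/forall_inP=> K SK.
by apply/forall_inP=> x Kx; apply/forall_inP=> y Ky; rewrite (sigK X SX K SK x y).
Qed.

Lemma cfdot_sigma X i : '[sigma_char X, 'chi_i] = (i \in X)%:R * 'chi_i 1%g.
Proof.
rewrite /sigma_char cfdot_suml (bigID (pred1 i)) /= addrC big1 => [|j /andP[_ nji]]; last first.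
  by rewrite cfdotZl cfdot_irr (negbTE nji) mulr0.
rewrite add0r; have [Xi | nXi] := boolP (i \in X).
  rewrite (bigD1 i) ?Xi ?eqxx //= cfdotZl cfdot_irr eqxx mulr1 mul1r big1 ?addr0 //.
  by move=> j /andP[/andP[_ ->]].
by rewrite mul0r big1 // => j /andP[Xj /eqP eji]; rewrite -eji Xj in nXi.
Qed.

Lemma sigma_charE X x : sigma_char X x = \sum_(i in X) 'chi_i 1%g * 'chi_i x.
Proof. by rewrite sum_cfunE; apply: eq_bigr => i _; rewrite cfunE. Qed.

Section OneTheory.

Variable S : sct_pair G.
Hypothesis sctS : is_sct S.

Let partK : partition S.1 G. Proof. by case/is_sctP: sctS. Qed.
Let partX : partition S.2 [set: Iirr G]. Proof. by case/is_sctP: sctS. Qed.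

Lemma sct_block_normal K : K \in S.1 -> K <| G.
Proof.
case/is_sctP: sctS => _ clK _ _ _ _ SK; apply/andP; split.
  exact: partition_block_sub SK.
apply/subsetP=> g Gg; rewrite inE; apply/subsetP=> _ /imsetP[x Kx ->].
by rewrite (subsetP (clK K SK x Kx)) // memJ_class.
Qed.

Lemma cfuni_block K : K \in S.1 -> block_fun S '1_K.
Proof.
move=> SK L SL x y Lx Ly; rewrite !cfuniE ?sct_block_normal //.
have [Kx | nKx] := boolP (x \in K).
  by rewrite (partition_block_eq partK SK SL Kx Lx) Ly.
have [Ky | //] := boolP (y \in K).
by rewrite (partition_block_eq partK SK SL Ky Ly) Lx in nKx.
Qed.

Lemma block_funE f : block_fun S f -> f = \sum_(K in S.1) f (repr K) *: '1_K.
Proof.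
move=> fK; apply/cfunP=> x; rewrite sum_cfunE.
have [Gx | nGx] := boolP (x \in G); last first.
  rewrite cfun0 // big1 // => K SK; rewrite cfunE cfuniE ?sct_block_normal //.
  suffices ->: (x \in K) = false by rewrite mulr0.
  by apply: contraNF nGx; apply: subsetP (partition_block_sub partK SK) x.
have [SK Kx] := pblock_partition partK Gx.
rewrite (bigD1 (pblock S.1 x)) //= big1 => [|L /andP[SL neqL]].
  rewrite cfunE cfuniE ?sct_block_normal // Kx mulr1 addr0.
  exact: fK SK _ _ Kx (mem_repr x Kx).
rewrite cfunE cfuniE ?sct_block_normal //.
suffices ->: (x \in L) = false by rewrite mulr0.
by apply: contraNF neqL => Lx; rewrite (partition_block_eq partK SL SK Lx Kx).
Qed.

(* The supercharacters are orthogonal and lie in the span of the indicators of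
   the superclasses; |K| = |X| makes the two spans equal. *)
Lemma block_fun_span f :
  block_fun S f -> f \in <<[seq sigma_char X | X <- enum S.2]>>%VS.
Proof.
pose V := <<[seq '1_K : 'CF(G) | K : {set gT} <- enum S.1]>>%VS.
have blockV g : block_fun S g -> g \in V.
  move=> gK; rewrite (block_funE gK) memv_suml // => K SK.
  by rewrite memvZ // memv_span // map_f // mem_enum.
set s := map _ _; move=> fK; suffices /eqP->: <<s>>%VS == V by apply: blockV.
case/is_sctP: sctS => _ _ _ cardKX _ sigK.
have injs : {in S.2 &, injective (@sigma_char _ G)}.
  move=> X Y SX SY eqXY; have [i Xi] := partition_block_neq0 partX SX.
  have := cfdot_sigma Y i; rewrite -eqXY cfdot_sigma Xi mul1r => /eqP.
  have [Yi _ | nYi] := boolP (i \in Y); first exact: (partition_block_eq partX SX SY Xi Yi).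
  by rewrite mul0r (negPf (irr1_neq0 i)).
have free_s : free s.
  apply: orthogonal_free; apply/pairwise_orthogonalP; split=> [|phi xi].
    rewrite /= map_inj_in_uniq ?enum_uniq ?andbT => [|X Y]; last first.
      by rewrite !mem_enum; apply: injs.
    apply/mapP=> [[X]]; rewrite mem_enum => SX sX0.
    have [i Xi] := partition_block_neq0 partX SX.
    have := cfdot_sigma X i; rewrite -sX0 cfdot0l Xi mul1r => /eqP.
    by rewrite eq_sym (negPf (irr1_neq0 i)).
  case/mapP=> X; rewrite mem_enum => SX -> /mapP[Y]; rewrite mem_enum => SY -> neqXY.
  rewrite (cfun_sum_cfdot (sigma_char Y)) cfdot_sumr big1 // => i _.
  rewrite cfdotZr !cfdot_sigma; have [Xi | _] := boolP (i \in X); last first.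
    by rewrite !mul0r mulr0.
  suffices ->: (i \in Y) = false by rewrite mul0r rmorph0 mul0r.
  by apply: contraNF neqXY => Yi; rewrite (partition_block_eq partX SX SY Xi Yi).
rewrite eqEdim (eqnP free_s) size_map -cardE -cardKX.
rewrite (leq_trans (dim_span _)) ?size_map -?cardE // andbT.
by apply/span_subvP=> phi /mapP[X]; rewrite mem_enum => SX ->; apply/blockV/sigK.
Qed.

(** By the spanning result [f] is a combination of the [sigma_char Y], in which the coefficient of
    ['chi_i] is ['chi_i 1] or 0 according to the part of [i]. Thus ['[f, 'chi_i] / 'chi_i 1] is
    constant on parts, stated here without division. *)
Lemma block_fun_ratio f X : block_fun S f -> X \in S.2 ->
  {in X &, forall i j, '[f, 'chi_i] * 'chi_j 1%g = '[f, 'chi_j] * 'chi_i 1%g}.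
Proof.
move/block_fun_span; set s := map _ _ => sf SX i j Xi Xj.
rewrite (coord_span (X := in_tuple s) sf) !cfdot_suml !mulr_suml; apply: eq_bigr => k _.
rewrite !cfdotZl /=; have /mapP[Y]: s`_k \in s by rewrite mem_nth.
rewrite mem_enum => SY ->; rewrite !cfdot_sigma.
suffices -> : (i \in Y) = (j \in Y) by rewrite -!mulrA ['chi_i _ * _]mulrC.
by apply/idP/idP=> [Yi | Yj];
  [rewrite -(partition_block_eq partX SX SY Xi Yi)
  |rewrite -(partition_block_eq partX SX SY Xj Yj)].
Qed.

(** The converse, tested on one function: [sigma_char X], for the part [X] of [i], has a nonzero
    coefficient at [i] and none outside [X]. Hence the superclasses determine the parts. *)
Lemma same_part_ratio i j :
  (forall f, block_fun S f -> '[f, 'chi_i] * 'chi_j 1%g = '[f, 'chi_j] * 'chi_i 1%g) ->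
  j \in pblock S.2 i.
Proof.
have [SX Xi] := pblock_partition partX (in_setT i); case/is_sctP: sctS => _ _ _ _ _ sigK.
move/(_ _ (sigK _ SX)); rewrite !cfdot_sigma Xi mul1r; apply: contra_eqT => /negPf->.
by rewrite !mul0r mulf_neq0 ?irr1_neq0.
Qed.

(** Grouping by parts turns each side into a linear combination of values of the [sigma_char X]. *)
Lemma eq_ratio_sum (a : Iirr G -> algC) x y :
    (forall X, X \in S.2 -> {in X &, forall i j, a i = a j}) ->
    (forall X, X \in S.2 -> sigma_char X x = sigma_char X y) ->
  \sum_i a i * ('chi_i 1%g * 'chi_i x) = \sum_i a i * ('chi_i 1%g * 'chi_i y).
Proof.
move=> aX sigxy.
have sumT (F : Iirr G -> algC) : \sum_i F i = \sum_(X in S.2) \sum_(i in X) F i.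
  by rewrite -(set_partition_big _ partX); apply: eq_bigl => i; rewrite inE.
rewrite !sumT; apply: eq_bigr => X SX; have [i Xi] := partition_block_neq0 partX SX.
have toi z : \sum_(j in X) a j * ('chi_j 1%g * 'chi_j z) = a i * sigma_char X z.
  by rewrite sigma_charE mulr_sumr; apply: eq_bigr => j Xj; rewrite (aX X SX j i).
by rewrite !toi sigxy.
Qed.

Lemma block_fun_expansion f : block_fun S f ->
  exists2 a : Iirr G -> algC,
    forall X, X \in S.2 -> {in X &, forall i j, a i = a j}
  & f = \sum_i a i *: ('chi_i 1%g *: 'chi_i).
Proof.
move=> fK; exists (fun i => '[f, 'chi_i] / 'chi_i 1%g) => [X SX i j Xi Xj|].
  by apply/eqP; rewrite eqr_div ?irr1_neq0 // (block_fun_ratio fK SX Xi Xj).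
rewrite {1}[f]cfun_sum_cfdot; apply: eq_bigr => i _.
by rewrite scalerA divfK ?irr1_neq0.
Qed.

Lemma block_fun_sigma f x y : block_fun S f ->
  (forall X, X \in S.2 -> sigma_char X x = sigma_char X y) -> f x = f y.
Proof.
case/block_fun_expansion=> a aX -> sigxy; rewrite !sum_cfunE.
under eq_bigr do rewrite !cfunE; under [RHS]eq_bigr do rewrite !cfunE.
exact: eq_ratio_sum.
Qed.

(** The indicator of the superclass of [x] is a combination of the [sigma_char X], so if all of
    these agree at [x] and [y], the indicator is 1 at [y] as well. *)
Lemma same_blockP x y : x \in G ->
  reflect (forall X, X \in S.2 -> sigma_char X x = sigma_char X y)
          (y \in pblock S.1 x).
Proof.
move=> Gx; have [SK Kx] := pblock_partition partK Gx.
apply: (iffP idP) => [Ky X SX | sigxy].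
  by case/is_sctP: sctS => _ _ _ _ _ sigK; apply: sigK SX _ SK _ _ Kx Ky.
have := block_fun_sigma (cfuni_block SK) sigxy.
rewrite !cfuniE ?sct_block_normal // Kx; case: (y \in _) => // /eqP.
by rewrite oner_eq0.
Qed.

(** By generalized orthogonality, convolution multiplies the weights [a i] and [b i] up to the
    factor |G|, and a product of weights constant on parts is again constant on parts. *)
Lemma block_fun_convolution f g K : block_fun S f -> block_fun S g -> K \in S.1 ->
  {in K &, forall y z, \sum_(x in G) f (x * y)%g * g x^-1%g
                     = \sum_(x in G) f (x * z)%g * g x^-1%g}.
Proof.
case/block_fun_expansion=> a aX fE /block_fun_expansion[b bX gE] SK.
have convE y : \sum_(x in G) f (x * y)%g * g x^-1%g
    = #|G|%:R * \sum_i a i * b i * ('chi_i 1%g * 'chi_i y).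
  transitivity (\sum_i \sum_j a i * 'chi_i 1%g * (b j * 'chi_j 1%g)
      * \sum_(x in G) 'chi_i (x * y)%g * 'chi_j x^-1%g).
    under [RHS]eq_bigr do under eq_bigr do rewrite mulr_sumr.
    under [RHS]eq_bigr do rewrite exchange_big.
    rewrite [RHS]exchange_big; apply: eq_bigr => x _.
    rewrite fE gE !sum_cfunE mulr_suml.
    apply: eq_bigr => i _; rewrite mulr_sumr; apply: eq_bigr => j _.
    by rewrite !cfunE [RHS]mulrACA !mulrA.
  rewrite mulr_sumr; apply: eq_bigr => i _.
  have orth j : \sum_(x in G) 'chi_i (x * y)%g * 'chi_j x^-1%g
      = #|G|%:R * ((i == j)%:R * ('chi_i y / 'chi_i 1%g)).
    by rewrite -generalized_orthogonality_relation mulVKf // neq0CG.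
  rewrite (bigD1 i) //= [X in _ + X]big1 => [|j neji]; last first.
    by rewrite orth eq_sym (negPf neji) mul0r !mulr0.
  rewrite addr0 orth eqxx mul1r [_ / _]mulrC.
  rewrite mulrCA; congr (_ * _); rewrite -!mulrA; congr (_ * _).
  by rewrite mulrCA; congr (_ * _); rewrite mulVKf ?irr1_neq0.
move=> y z Ky Kz; rewrite !convE; congr (_ * _); apply: eq_ratio_sum => X SX.
  move=> i j Xi Xj; by rewrite (aX X SX i j) // (bX X SX i j).
by case/is_sctP: sctS => _ _ _ _ _ sigK; apply: sigK SX _ SK _ _ Ky Kz.
Qed.

End OneTheory.

(** * Action of automorphisms and of Galois morphisms on a theory *)

Section Automorphisms.

Variable a : {perm gT}.
Hypothesis AutGa : a \in Aut G.

Let isomGa : isom G G (autm AutGa).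
Proof. by apply/isomP; rewrite injm_autm im_autm. Qed.

Let tau : Iirr G -> Iirr G := isom_Iirr isomGa.

Lemma aut_group_mem x : (a x \in G) = (x \in G).
Proof. by case/setIdP: AutGa => onGa _; rewrite perm_closed. Qed.

Lemma aut_imset_group : a @: G = G.
Proof. by case/setIdP: AutGa => onGa _; rewrite im_perm_on. Qed.

Lemma autM : {in G &, {morph a : x y / (x * y)%g}}.
Proof. by case/setIdP: AutGa => _ /morphicP. Qed.

Lemma autV : {in G, {morph a : x / (x^-1)%g}}.
Proof. by move=> x Gx; rewrite -(autmE AutGa) morphV. Qed.

Lemma autX m : {in G, {morph a : x / (x ^+ m)%g}}.
Proof. by move=> x Gx; rewrite -(autmE AutGa) morphX. Qed.

Lemma aut_cfIsom f x : x \in G -> cfIsom isomGa f (a x) = f x.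
Proof. by move=> Gx; rewrite -(autmE AutGa) cfIsomE. Qed.

(** Trades the pointwise definition for the index permutation [tau] induced by the isometry
    [cfIsom], to which [imset_partition_id] applies. *)
Lemma aut_act_irrE X : aut_act_irr a X = tau @: X.
Proof.
apply/setP=> j; rewrite inE; apply/exists_inP/imsetP=> [[i Xi /forall_inP ji] | [i Xi ->]].
  exists i => //; apply: irr_inj; apply/cfun_inP=> x; rewrite -{1}aut_imset_group.
  case/imsetP=> y Gy ->; rewrite isom_IirrE aut_cfIsom //.
  by rewrite (eqP (ji _ _)) ?permK // aut_group_mem.
exists i => //; apply/forall_inP=> x; rewrite -{1}aut_imset_group => /imsetP[y Gy ->].
by rewrite isom_IirrE aut_cfIsom // permK.
Qed.

Section PreservesBlocks.

Variable S : sct_pair G.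
Hypothesis sctS : is_sct S.
Hypothesis aS : {in G &, forall x y, (a y \in pblock S.1 (a x)) = (y \in pblock S.1 x)}.

Let partK : partition S.1 G. Proof. by case/is_sctP: sctS. Qed.
Let partX : partition S.2 [set: Iirr G]. Proof. by case/is_sctP: sctS. Qed.

Lemma aut_superclasses_id : [set a @: K | K : {set gT} in S.1] = S.1.
Proof.
exact: imset_partition_id partK (in2W (@perm_inj _ a)) aut_imset_group aS.
Qed.

Let block_fun_cfIsom f : block_fun S (cfIsom isomGa f) <-> block_fun S f.
Proof.
split=> fK K SK x y Kx Ky.
  have [Gx Gy] : x \in G /\ y \in G.
    by split; apply: (subsetP (partition_block_sub partK SK)).
  rewrite -(aut_cfIsom f Gx) -(aut_cfIsom f Gy); apply: (fK (a @: K)); rewrite ?imset_f //.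
  by rewrite -aut_superclasses_id imset_f.
move: SK; rewrite -aut_superclasses_id => /imsetP[L SL defK].
move: Kx Ky; rewrite defK => /imsetP[u Lu ->] /imsetP[v Lv ->].
have sLG := subsetP (partition_block_sub partK SL).
by rewrite !aut_cfIsom ?sLG // (fK L SL u v).
Qed.

(** Stability of the superclasses suffices: [cfIsom] then preserves superclass functions in both
    directions, and sharing a part is a condition on their scalar products, by [block_fun_ratio] and
    [same_part_ratio]. *)
Lemma aut_act_id : aut_act a S = S.
Proof.
case: S sctS aS partK partX aut_superclasses_id block_fun_cfIsom => K X /= sct aKX pK pX.
rewrite /aut_act /superclasses /superchar_parts /= => -> cfK; congr pair.
under eq_imset do rewrite aut_act_irrE.
have tauT : tau @: setT = setT.
  by apply/eqP; rewrite eqEcard subsetT (card_imset _ (isom_Iirr_inj isomGa)) leqnn.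
apply: (imset_partition_id pX (in2W (@isom_Iirr_inj _ _ _ _ _ isomGa)) tauT) => i j _ _.
have [Xi ii] := pblock_partition pX (in_setT i).
have [Xti tii] := pblock_partition pX (in_setT (tau i)).
have tau1 k : 'chi_(tau k) 1%g = 'chi_k 1%g by rewrite isom_IirrE cfIsom1.
have dot_tau g k : '[cfIsom isomGa g, 'chi_(tau k)] = '[g, 'chi_k].
  by rewrite isom_IirrE cfIsom_iso.
apply/idP/idP=> [ij | ij]; apply: (same_part_ratio sct) => f fK.
  rewrite -(dot_tau f i) -(dot_tau f j) -(tau1 i) -(tau1 j).
  by apply: (block_fun_ratio sct _ Xti tii ij); apply/cfK.
move: fK; rewrite -(cfIsomKV isomGa f); move: (cfIsom _ f) => g /cfK gK.
rewrite (dot_tau g i) (dot_tau g j) (tau1 i) (tau1 j).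
exact: (block_fun_ratio sct gK Xi ii ij).
Qed.

End PreservesBlocks.

End Automorphisms.

Lemma CharSCTP S :
  reflect (is_sct S /\ forall a, a \in Aut G -> aut_act a S = S) (S \in CharSCT G).
Proof.
rewrite /CharSCT inE [S \in _]inE; apply: (iffP andP) => [[sctS /forall_inP aS]|[sctS aS]].
  by split=> // a /aS/eqP.
by split=> //; apply/forall_inP=> a /aS/eqP.
Qed.

Lemma SCT_E S : (S \in SCT G) = is_sct S.
Proof. by rewrite inE. Qed.

(** Restricted to the cyclic group of [x], a character is a sum of linear characters with natural
    multiplicities, and their values at [x] are [n]-th roots of unity, which [u] raises to the power
    [k]. *)
Lemma char_expn_aut (phi : 'CF(G)) x k n (u : {rmorphism algC -> algC}) :
    phi \is a character -> x \in G -> (x ^+ n)%g = 1%g ->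
    (forall z, z ^+ n = 1 -> u z = z ^+ k) ->
  phi (x ^+ k)%g = u (phi x).
Proof.
move=> Nphi Gx xn1 un; have sxG: <[x]> \subset G by rewrite cycle_subG.
rewrite -(cfResE phi sxG (cycle_id x)) -(cfResE phi sxG (mem_cycle x k)).
rewrite ['Res phi]cfun_sum_cfdot !sum_cfunE rmorph_sum; apply: eq_bigr => i _.
have lin_i : 'chi_i \is a linear_char by apply/char_abelianP/cycle_abelian.
have /Num.Theory.natrP[m ->] : '['Res[<[x]>] phi, 'chi_i] \in Num.nat.
  by rewrite Cnat_cfdot_char_irr ?cfRes_char.
rewrite !cfunE rmorphM rmorph_nat (lin_charX lin_i k (cycle_id x)) un //.
by rewrite -(lin_charX lin_i n (cycle_id x)) xn1 lin_char1.
Qed.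

Lemma sigma_expn_aut X x k n (u : {rmorphism algC -> algC}) :
    x \in G -> (x ^+ n)%g = 1%g -> (forall z, z ^+ n = 1 -> u z = z ^+ k) ->
  sigma_char X (x ^+ k)%g = u (sigma_char X x).
Proof.
move=> Gx xn1 un; rewrite !sigma_charE rmorph_sum; apply: eq_bigr => i _.
rewrite rmorphM (char_expn_aut (irr_char i) Gx xn1 un); congr (_ * _).
by have /Num.Theory.natrP[m ->] := Cnat_irr1 i; rewrite rmorph_nat.
Qed.

(** A field morphism acting on [n]-th roots of unity as the power [k] sends [sigma_char X x] to
    [sigma_char X (x ^+ k)]; being injective, it transports equality of values both ways. *)
Lemma expn_same_block S x y k n : is_sct S ->
    x \in G -> y \in G -> (x ^+ n)%g = 1%g -> (y ^+ n)%g = 1%g -> coprime k n ->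
  ((y ^+ k)%g \in pblock S.1 (x ^+ k)%g) = (y \in pblock S.1 x).
Proof.
move=> sctS Gx Gy xn1 yn1 /Qn_aut_exists[u un].
apply/same_blockP/same_blockP=> //; rewrite ?groupX // => sigxy X SX.
  by have:= sigxy X SX; rewrite !(sigma_expn_aut X _ _ un) // => /fmorph_inj.
by rewrite !(sigma_expn_aut X _ _ un) ?sigxy.
Qed.

Lemma lin_char_of_morphism (h : gT -> algC) :
    h 1%g = 1 -> {in G &, {morph h : x y / (x * y)%g >-> x * y}} ->
  exists2 i : Iirr G, 'chi_i \is a linear_char & {in G, 'chi_i =1 h}.
Proof.
move=> h1 hM; have reprh : mx_repr G (fun x => (h x)%:M : 'M_1).
  by split=> [|x y Gx Gy]; rewrite ?h1 // hM // scalar_mxM.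
have phiE x : x \in G -> cfRepr (MxRepresentation reprh) x = h x.
  by move=> Gx; rewrite cfunE Gx mulr1n mxtrace_scalar.
have lin_phi : cfRepr (MxRepresentation reprh) \is a linear_char.
  by rewrite qualifE /= cfRepr_char phiE ?h1 /=.
have /irrP[i def_i] := lin_char_irr lin_phi.
by exists i => [|x Gx]; rewrite -def_i ?phiE.
Qed.

Lemma index2_lin_char (H : {group gT}) : H \subset G -> #|G : H| = 2 ->
  exists2 i : Iirr G, 'chi_i \is a linear_char
    & {in G, forall x, 'chi_i x = (-1) ^+ (x \notin H)}.
Proof.
move=> sHG iGH; apply: lin_char_of_morphism => [|x y Gx Gy]; first by rewrite group1.
have [Hx | nHx] := boolP (x \in H); first by rewrite groupMl // mul1r.
have [Hy | nHy] := boolP (y \in H); first by rewrite groupMr // (negPf nHx) mulr1.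
(* The complement of a subgroup of index 2 is a single coset, so two elements outside [H] multiply
   into [H]. *)
suffices -> : (x * y)%g \in H by rewrite -expr2 sqrrN expr1n.
have GHy : (y^-1)%g \in G :\: H by rewrite inE !groupV nHy.
have: x \in G :\: H by rewrite inE nHx.
by rewrite -(rcoset_index2 sHG iGH GHy) mem_rcoset invgK.
Qed.

End SupercharacterTheory.

(** * Structure of the dihedral group *)

Section DihedralGroup.

Variables (gT : finGroupType) (G : {group gT}) (r s : gT) (n : nat).
Hypotheses (n_gt0 : (0 < n)%N) (dihG : is_dihedral G r s n).

Let R := <[r]>%G.
Let Q := <[r ^+ 2]>%G.

Lemma dihedral_inG : r \in G /\ s \in G.
Proof. by case: dihG => -> _ _ _ _; rewrite !mem_gen // !inE eqxx ?orbT. Qed.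

Lemma dihedral_sV : s^-1 = s.
Proof. by case: dihG => _ _ _ s2 _; apply/eqP; rewrite eq_invg_mul -expg2 s2. Qed.

Lemma dihedral_conj_s x : x \in R -> x ^ s = x^-1.
Proof.
case: dihG => _ _ _ _ srs /cycleP[i ->]; rewrite conjXg -expgVn; congr (_ ^+ i).
by rewrite conjgE dihedral_sV mulgA srs.
Qed.

Lemma dihedral_defG : (R * <[s]>)%g = G.
Proof.
case: dihG => -> _ _ _ _; rewrite -norm_joinEr; first by rewrite joing_idl joing_idr.
by rewrite norms_cycle dihedral_conj_s ?cycle_id // groupV cycle_id.
Qed.

(** The relations only bound the orders of [r] and [s] from above; the order [2 * n] of [G], through
    the product formula for [R] and [<[s]>], makes the bound for [r] sharp and excludes [s] from
    [R]. *)
Lemma dihedral_orders : #[r] = n /\ s \notin R.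
Proof.
case: dihG => _ oG rn1 s2 _.
have rn : #[r] <= n by rewrite dvdn_leq // order_dvdn rn1.
have sn : #[s] <= 2 by rewrite dvdn_leq // order_dvdn s2.
have := mul_cardG R <[s]>; rewrite dihedral_defG oG -!orderE => card_eq.
have I_gt0 : 0 < #|R :&: <[s]>| by apply: cardG_gt0.
have n2_le : n * 2 <= #[r] * #[s] by rewrite card_eq mulnC leq_pmulr.
have or : #[r] = n.
  apply/eqP; rewrite eqn_leq rn /= -(leq_pmul2r (isT : 0 < 2)) (leq_trans n2_le) //.
  by rewrite leq_mul2l sn orbT.
split=> //; apply/negP=> Rs.
have os : #[s] = 2.
  by apply/eqP; rewrite eqn_leq sn -(leq_pmul2l n_gt0) -{2}or.
have := card_eq; rewrite (setIidPr _) ?cycle_subG // -orderE or os => /eqP.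
by rewrite eqn_mul2r /= -{1}[n]mul1n eqn_mul2r -leqn0 leqNgt n_gt0.
Qed.

Lemma dihedral_order : #[r] = n. Proof. by case: dihedral_orders. Qed.
Lemma dihedral_s_notin : s \notin R. Proof. by case: dihedral_orders. Qed.

Lemma dihedral_sRG : R \subset G.
Proof. by rewrite cycle_subG; case: dihedral_inG. Qed.

Lemma dihedral_index : #|G : R| = 2.
Proof.
case: dihG => _ oG _ _ _.
by rewrite -divgS ?dihedral_sRG // oG -orderE dihedral_order mulnK.
Qed.

Lemma dihedral_reflections : s *: R = G :\: R.
Proof.
have [_ Gs] := dihedral_inG.
have GRs : s \in G :\: R by rewrite inE dihedral_s_notin.
rewrite -norm_rlcoset ?(rcoset_index2 dihedral_sRG dihedral_index) //.
exact: subsetP (normal_norm (index2_normal dihedral_sRG dihedral_index)) s Gs.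
Qed.

Lemma dihedral_reflectionP y :
  reflect (exists2 z, z \in R & y = s * z) (y \in G :\: R).
Proof. by rewrite -dihedral_reflections; apply: lcosetP. Qed.

Lemma dihedral_invol y : y \in G :\: R -> y^-1 = y.
Proof.
case/dihedral_reflectionP=> z Rz ->; rewrite invMg dihedral_sV.
rewrite -(dihedral_conj_s Rz) conjgE dihedral_sV !mulgA -[_ * s * s]mulgA -expg2.
by case: dihG => _ _ _ -> _; rewrite mulg1.
Qed.

Lemma dihedral_conj x y : x \in R -> y \in G :\: R -> x ^ y = x^-1.
Proof.
move=> Rx /dihedral_reflectionP[z Rz ->]; rewrite conjgM dihedral_conj_s //.
have cRR : abelian R := cycle_abelian r.
by rewrite conjgE (centsP cRR x^-1 _ z) ?groupV // mulKg.
Qed.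

Lemma dihedral_sub_normal (N : {group gT}) : N \subset R -> N <| G.
Proof.
move=> sNR; rewrite /normal (subset_trans sNR dihedral_sRG); apply/subsetP=> y Gy.
rewrite inE; apply/subsetP=> _ /imsetP[x Nx ->]; have Rx := subsetP sNR x Nx.
have [Ry | nRy] := boolP (y \in R).
  have cRR : abelian R := cycle_abelian r.
  by rewrite conjgE (centsP cRR x _ y) // mulKg.
by rewrite dihedral_conj ?groupV // inE nRy.
Qed.

Lemma dihedral_mul_reflections x y :
  x \in G :\: R -> y \in G -> (x * y \in R) = (y \notin R).
Proof.
move=> GRx Gy; have /setDP[Gx nRx] := GRx.
have [Ry | nRy] := boolP (y \in R); first by rewrite groupMr // (negPf nRx).
have GRy : y \in G :\: R by rewrite inE nRy.
rewrite -(dihedral_invol GRx) -mem_lcoset; case/dihedral_reflectionP: GRx => z Rz ->.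
by rewrite lcosetM lcoset_id // dihedral_reflections GRy.
Qed.

(** Lets a result about [s] be reused for [s * r]; the character mu_1 is obtained in this way. *)
Lemma dihedral_shift : is_dihedral G r (s * r) n.
Proof.
case: dihG => defG oG rn s2 srs; have [Gr Gs] := dihedral_inG.
have GRsr : s * r \in G :\: R by apply/dihedral_reflectionP; exists r; rewrite ?cycle_id.
have sr_invol := dihedral_invol GRsr; split=> //.
- apply/eqP; rewrite eqEsubset {1}defG !gen_subG !subUset !sub1set groupM // Gr.
  rewrite mem_gen ?set21 //= -[X in X \in _](mulgK r).
  by rewrite groupM ?groupV // mem_gen ?set21 ?set22.
- by rewrite expg2 -{1}sr_invol mulVg.
by rewrite -(dihedral_conj (cycle_id r) GRsr) conjgE sr_invol !mulgA.
Qed.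

End DihedralGroup.

(** * Products with the theory [M] of a quotient *)

Section StarWithM.

Variables (gT : finGroupType) (G N : {group gT}).
Hypothesis nsNG : N <| G.

Lemma bigcup_quotientD1 : \bigcup_(gN in (G / N)^#) (gN : {set gT}) = G :\: N.
Proof.
have nNG := subsetP (normal_norm nsNG); apply/setP=> x; apply/bigcupP/setDP.
  case=> gN /setD1P[ntgN /morphimP[y Ny Gy def_gN]]; rewrite def_gN val_coset // => Nyx.
  split.
    by case/rcosetP: Nyx => z Nz ->; rewrite groupM // (subsetP (normal_sub nsNG)).
  apply: contra ntgN => Nx; rewrite def_gN; apply/eqP/coset_id.
  by case/rcosetP: Nyx Nx => z Nz ->; rewrite groupMl.
case=> Gx nNx; exists (coset N x); last by rewrite val_coset ?nNG ?rcoset_refl.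
rewrite !inE mem_quotient // andbT; apply: contra nNx => /eqP.
by apply: coset_idr; apply: nNG.
Qed.

(** As [N] is proper, the nontrivial block of [M] on [G / N] is nonempty, and the union of its
    cosets is [G :\: N]. *)
Lemma superclasses_star_M (S : sct_pair N) : ~~ (G \subset N) ->
  (sct_star S (sctM (G / N))).1 = G :\: N |: S.1.
Proof.
move=> nsGN; rewrite setUC /sct_star /superclasses /=; congr (_ :|: _).
have ntQ : (G / N)^# != set0 :> {set coset_of N}.
  apply: contra nsGN => /eqP Q0; rewrite -setD_eq0 -bigcup_quotientD1 Q0.
  by rewrite big_set0.
apply/setP=> A; rewrite inE; apply/imsetP/eqP=> [[L] | ->].
  rewrite !inE => /and3P[/negPf-> _ /=/eqP->] ->; exact: bigcup_quotientD1.
exists (G / N)^#; last by rewrite bigcup_quotientD1.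
rewrite !inE ntQ eqxx orbT !andbT; apply: contraNneq ntQ => /setP/(_ 1).
by rewrite !inE eqxx.
Qed.

End StarWithM.

(** * The intervals P_d and their disjointness *)

Section DihedralIntervals.

Variables (gT : finGroupType) (G : {group gT}) (r s : gT) (n : nat).
Hypotheses (n_gt0 : (0 < n)%N) (dihG : is_dihedral G r s n).

Let R := <[r]>%G.

(** The bound F_d puts [G :\: N] inside one superclass, and C_d keeps that superclass away from [N].
    Conversely, the other blocks of F_d are conjugacy classes, and the other superclasses of [S] are
    the identity or subsets of [N^#]. *)
Lemma sctP_E d S :
  (S \in sctP G r d) = is_sct S && (G :\: <[r ^+ d]> \in S.1).
Proof.
set N := <[r ^+ d]>%G; have sNR : N \subset R by apply: cycleX.
have nsNG := dihedral_sub_normal n_gt0 dihG sNR.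
have [_ Gs] := dihedral_inG dihG.
have GNs : s \in G :\: N.
  rewrite inE Gs andbT; apply: contra (dihedral_s_notin n_gt0 dihG).
  by apply: subsetP.
have nsGN : ~~ (G \subset N) by apply/subsetPn; exists s => //; case/setDP: GNs.
rewrite inE SCT_E; apply: andb_id2l => sctS; case/is_sctP: (sctS) => partK clK _ _ S1 _.
rewrite /sct_le /superclasses /sctF /sctC !superclasses_star_M //=.
apply/andP/idP=> [[/forall_inP FS /forall_inP SC] | SGN].
  have /exists_inP[B SB sGNB]: [exists B in S.1, G :\: N \subset B].
    by apply: FS; rewrite !inE eqxx.
  suffices <- : B = G :\: N by [].
  apply/eqP; rewrite eqEsubset sGNB andbT.
  have /exists_inP[C CC sBC] := SC B SB.
  (* Among the blocks of C_d only [G :\: N] contains [s]. *)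
  have Cs : s \in C by apply/(subsetP sBC)/(subsetP sGNB).
  move: CC; rewrite !inE => /orP[/eqP <- // | /andP[_ /orP[]/eqP defC]].
    by move: Cs; rewrite defC => /set1P s1; case/setDP: GNs; rewrite s1 !group1.
  by move: Cs; rewrite defC => /setD1P[_]; case/setDP: GNs => _ /negPf->.
split; apply/forall_inP=> A.
  case/setU1P=> [-> | /imsetP[x Nx ->]]; apply/exists_inP; first by exists (G :\: N).
  have Gx := subsetP (normal_sub nsNG) x Nx.
  have [SK Kx] := pblock_partition partK Gx.
  by exists (pblock S.1 x); last exact: clK.
move=> SA; apply/exists_inP; have [-> | neqAGN] := eqVneq A (G :\: N).
  by exists (G :\: N); rewrite ?setU11.
have [-> | neqA1] := eqVneq A [set 1%g].
  exists [set 1%g] => //; rewrite !inE eqxx orbC andbT.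
  by apply/orP; left; apply/set0Pn; exists 1; rewrite inE.
have [x Ax] := partition_block_neq0 partK SA.
have sAN : A \subset N^#.
  apply/subsetP=> y Ay; have Gy := subsetP (partition_block_sub partK SA) y Ay.
  rewrite !inE; apply/andP; split.
    apply: contraNneq neqA1 => y1; apply/eqP.
    by apply: (partition_block_eq partK SA S1 Ay); rewrite y1 set11.
  apply: contraNT neqAGN => nNy; apply/eqP.
  by apply: (partition_block_eq partK SA SGN Ay); rewrite inE nNy.
exists N^# => //; rewrite !inE eqxx orbT andbT orbC.
by apply/orP; left; apply/set0Pn; exists x; apply: (subsetP sAN).
Qed.

(** A common member would have the superclasses [G :\: <[r ^+ d]>] and [G :\: <[r ^+ e]>], both
    containing [s] and hence equal; then [n %/ d] and [n %/ e] agree. *)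
Lemma sctP_disjoint d e : d %| n -> e %| n -> d != e ->
  [disjoint sctP G r d & sctP G r e].
Proof.
move=> dvd_d dvd_e neq_de; apply/pred0P=> S /=; rewrite !sctP_E.
apply: contraNF neq_de => /andP[/andP[sctS Sd] /andP[_ Se]].
case/is_sctP: sctS => partK _ _ _ _ _; have [_ Gs] := dihedral_inG dihG.
have ns := dihedral_s_notin n_gt0 dihG.
have GNs k : s \in G :\: <[r ^+ k]>.
  by rewrite inE Gs andbT; apply: contra ns; apply: subsetP; apply: cycleX.
have eqGN := partition_block_eq partK Sd Se (GNs d) (GNs e).
have sXG k : <[r ^+ k]> \subset G by apply: subset_trans (cycleX r k) (dihedral_sRG dihG).
have eqN : <[r ^+ d]> = <[r ^+ e]>.
  have GDDX k : G :\: (G :\: <[r ^+ k]>) = <[r ^+ k]>.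
    by rewrite setDDr setDv set0U; apply/setIidPr.
  by rewrite -(GDDX d) eqGN GDDX.
have ord k : k %| n -> #[r ^+ k] = n %/ k.
  by move=> dvd_k; rewrite orderXdiv (dihedral_order n_gt0 dihG).
have := ord d dvd_d; rewrite orderE eqN -orderE ord // => /eqP.
move=> eq_q; rewrite -(eqn_pmul2l (_ : 0 < n %/ d)%N) ?divn_gt0 ?(dvdn_leq n_gt0) ?(dvdn_gt0 n_gt0) //.
by rewrite -[in X in _ == X](eqP eq_q) !divnK.
Qed.

End DihedralIntervals.

(** * Automorphisms of the dihedral group and the theories in P_d *)

Section DihedralAutomorphisms.

Variables (gT : finGroupType) (G : {group gT}) (r s : gT) (n : nat).
Hypotheses (n_gt0 : (0 < n)%N) (dihG : is_dihedral G r s n).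

Let R := <[r]>%G.
Let Q := <[r ^+ 2]>%G.

(** If [a r] were a reflection, [r] would have order dividing 2. Order 1 is impossible since then
    [a r] is trivial; order 2 is excluded because the Klein four-group does have automorphisms
    moving [r] out of [R]. *)
Lemma dihedral_aut_power a : a \in Aut G -> n != 2 ->
  exists2 k, coprime k n & {in R, forall x, a x = x ^+ k}.
Proof.
move=> AutGa n2; have [Gr _] := dihedral_inG dihG.
have Ra : a r \in R.
  have [//| nRar] := boolP (a r \in R); have Gar : a r \in G by rewrite aut_group_mem.
  have /perm_inj r_inv : a r^-1 = a r.
    by rewrite (autV AutGa) // (dihedral_invol n_gt0 dihG) // inE nRar.
  have : #[r] %| 2 by rewrite order_dvdn expg2 -{1}r_inv mulVg.
  rewrite (dihedral_order n_gt0 dihG) dvdn_divisors // !inE (negPf n2) orbF => /eqP n1.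
  have r1 : r = 1 by apply/eqP; rewrite -order_eq1 (dihedral_order n_gt0 dihG) n1.
  by move: nRar; rewrite -(autmE AutGa) r1 morph1 group1.
have /cycleP[k ark] := Ra; exists k => [|_ /cycleP[i ->]]; last first.
  by rewrite (autX AutGa) // ark -!expgM mulnC.
have : #[a r] = #[r] by rewrite -(autmE AutGa) order_injm ?injm_autm.
rewrite ark orderXgcd (dihedral_order n_gt0 dihG) => /eqP.
rewrite -(eqn_pmul2r (_ : 0 < gcdn n k)%N) ?gcdn_gt0 ?n_gt0 // divnK ?dvdn_gcdl //.
by rewrite -{1}[n]muln1 eqn_pmul2l // eq_sym gcdnC.
Qed.

Lemma dihedral_aut_mem a (N : {group gT}) x : a \in Aut G -> n != 2 ->
  N \subset R -> (a x \in N) = (x \in N).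
Proof.
move=> AutGa n2 sNR; have [k _ ak] := dihedral_aut_power AutGa n2.
suffices aN : a @: N = N by rewrite -{1}aN mem_imset //; apply: perm_inj.
apply/eqP; rewrite eqEcard card_imset ?leqnn ?andbT; last exact: perm_inj.
by apply/subsetP=> _ /imsetP[y Ny ->]; rewrite ak ?groupX // (subsetP sNR).
Qed.

(** Within [N] the automorphism is a power map with exponent prime to [n], so the Galois argument
    applies; a mixed pair is reduced by symmetry to the assumption on [G :\: N]. *)
Lemma dihedral_aut_blocks a (N : {group gT}) (S : sct_pair G) : is_sct S -> a \in Aut G -> n != 2 ->
    N \subset R ->
    {in G :\: N & G, forall x y, (a y \in pblock S.1 (a x)) = (y \in pblock S.1 x)} ->
  aut_act a S = S.
Proof.
move=> sctS AutGa n2 sNR aS; apply: (aut_act_id AutGa) => // x y Gx Gy.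
case/is_sctP: (sctS) => partK _ _ _ _ _.
have [Nx | nNx] := boolP (x \in N); last by rewrite aS // inE nNx.
have [Ny | nNy] := boolP (y \in N); last first.
  rewrite (pblock_sym partK Gx Gy) -(aS y x) ?inE ?nNy //.
  by rewrite (pblock_sym partK) ?(aut_group_mem AutGa).
have [k co_k ak] := dihedral_aut_power AutGa n2.
have NX1 z : z \in N -> z ^+ n = 1.
  move=> Nz; apply/eqP; rewrite -order_dvdn -(dihedral_order n_gt0 dihG).
  by apply: order_dvdG; apply: (subsetP sNR).
by rewrite !ak ?(subsetP sNR) // (expn_same_block sctS _ _ (NX1 x Nx) (NX1 y Ny)).
Qed.

(** Automorphisms preserve [<[r ^+ d]>], hence its complement. For [n = 2] this fails: the theory
    with superclasses {1}, {r}, {s, sr} is in P_1, but some automorphism swaps [r] and [s]. *)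
Lemma sctP_CharSCT d S : n != 2 -> S \in sctP G r d -> S \in CharSCT G.
Proof.
move=> n2; rewrite (sctP_E n_gt0 dihG) => /andP[sctS SGN].
apply/CharSCTP; split=> // a AutGa; have sNR : <[r ^+ d]> \subset R by apply: cycleX.
case/is_sctP: (sctS) => partK _ _ _ _ _.
apply: (dihedral_aut_blocks sctS AutGa n2 sNR) => x y GNx Gy.
rewrite !(pblock_partition_eq partK SGN) //.
  by rewrite !inE (aut_group_mem AutGa) (dihedral_aut_mem _ AutGa n2 sNR).
by move: GNx; rewrite !inE (aut_group_mem AutGa) (dihedral_aut_mem _ AutGa n2 sNR).
Qed.

End DihedralAutomorphisms.

(** * Conjugacy classes of reflections, and a second subgroup of index 2 *)

Section DihedralEven.

Variables (gT : finGroupType) (G : {group gT}) (r s : gT) (n : nat).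
Hypotheses (n_gt0 : (0 < n)%N) (dihG : is_dihedral G r s n).

Let R := <[r]>%G.
Let Q := <[r ^+ 2]>%G.

Lemma dihedral_class x : x \in G :\: R -> x ^: G = x *: Q.
Proof.
move=> GRx; have /setDP[Gx nRx] := GRx; have [Gr Gs] := dihedral_inG dihG.
have xV := dihedral_invol n_gt0 dihG GRx.
have conjR w : w \in R -> x ^ w = x * w ^+ 2.
  move=> Rw; rewrite conjgE -(dihedral_conj n_gt0 dihG Rw GRx) conjgE.
  by rewrite xV !mulgA -(mulgA _ x x) -{3}xV mulgV mulg1 -mulgA.
have sqQ w : w \in R -> w ^+ 2 \in Q.
  by case/cycleP=> i ->; rewrite -expgM mulnC expgM mem_cycle.
apply/setP=> y; apply/imsetP/lcosetP=> [[g Gg ->] | [z /cycleP[i ->] ->]].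
  have [Rg | nRg] := boolP (g \in R); first by exists (g ^+ 2); rewrite ?sqQ ?conjR.
  (* Conjugating [x] by [g] or by the rotation [x * g] gives the same result, since [x] commutes
     with itself. *)
  have Rxg : x * g \in R by rewrite (dihedral_mul_reflections n_gt0 dihG).
  exists ((x * g) ^+ 2); first exact: sqQ.
  by rewrite -conjR // conjgM [x ^ x]conjgE mulKg.
by exists (r ^+ i); rewrite ?groupX // conjR ?mem_cycle // -!expgM mulnC.
Qed.

Lemma reflections_split : (s *: Q) :|: ((s * r) *: Q) = s *: R.
Proof.
have memQ k : r ^+ k.*2 \in Q by rewrite -mul2n expgM mem_cycle.
have sQR : Q \subset R by apply: cycleX.
apply/setP=> x; apply/setUP/lcosetP=> [[]/lcosetP[z Qz ->] | [_ /cycleP[k ->] ->]].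
- by exists z; rewrite ?(subsetP sQR).
- by exists (r * z); rewrite ?mulgA // groupM ?cycle_id // (subsetP sQR).
rewrite -(odd_double_half k); case: (odd k) => /=.
  by right; rewrite mem_lcoset add1n expgS [s * (r * _)]mulgA mulKg.
by left; rewrite mem_lcoset mulKg add0n.
Qed.

Hypothesis n_even : ~~ odd n.

(** The subgroup generated by [r ^+ 2] and [s] has order [n] because [n] is even, and with [r] it
    would be all of [G]. *)
Lemma dihedral_half_subgroup :
  exists H : {group gT}, [/\ H \subset G, #|G : H| = 2, s \in H & r \notin H].
Proof.
have [Gr Gs] := dihedral_inG dihG; have sQR : Q \subset R by apply: cycleX.
have ns := dihedral_s_notin n_gt0 dihG.
have sHG : Q <*> <[s]> \subset G by rewrite join_subG !cycle_subG groupX.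
have os : #[s] = 2.
  apply: nt_prime_order => //; first by case: dihG.
  by apply: contraNneq ns => ->; rewrite group1.
have nQs : <[s]> \subset 'N(Q).
  apply: subset_trans (normal_norm (dihedral_sub_normal n_gt0 dihG sQR)).
  by rewrite cycle_subG.
have tiQs : Q :&: <[s]> = 1.
  rewrite setIC prime_TIg -?orderE ?os // cycle_subG.
  by apply: contra ns; apply: subsetP.
have n2 : 2 %| n by rewrite dvdn2.
have oH : #|Q <*> <[s]>| = n.
  by rewrite norm_joinEr // TI_cardMg // -!orderE os orderXdiv (dihedral_order n_gt0 dihG) ?divnK.
have iH : #|G : Q <*> <[s]>| = 2.
  by rewrite -divgS // oH; case: dihG => _ -> _ _ _; rewrite mulnK.
have Hs : s \in Q <*> <[s]> by rewrite mem_gen // inE cycle_id orbT.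
exists (Q <*> <[s]>)%G; split=> //; apply/negP=> Hr.
have sGH : G \subset Q <*> <[s]>.
  by case: dihG => -> _ _ _ _; rewrite gen_subG subUset !sub1set Hr.
by move: iH; rewrite (eqP (_ : Q <*> <[s]> == G)) ?eqEsubset ?sHG // indexgg.
Qed.


End DihedralEven.

(** * The linear characters mu_0 and mu_1 *)

Section LinearCharacters.

Variables (gT : finGroupType) (G : {group gT}) (r s : gT) (n : nat).
Hypotheses (n_gt0 : (0 < n)%N) (dihG : is_dihedral G r s n) (n_even : ~~ odd n).

Let R := <[r]>%G.
Let Q := <[r ^+ 2]>%G.

Lemma mu_exists (b : bool) : exists i : Iirr G,
  [/\ 'chi_i \is a linear_char, 'chi_i r = -1 & 'chi_i s = (-1) ^+ b]%R.
Proof.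
have [Gr Gs] := dihedral_inG dihG; case: b; last first.
  have [H [sHG iH Hs nHr]] := dihedral_half_subgroup n_gt0 dihG n_even.
  have [i lin_i iE] := index2_lin_char sHG iH.
  by exists i; rewrite !iE // Hs (negPf nHr).
(* For mu_1 the pair [r], [s * r] replaces [r], [s]: the sign character is 1 at [s * r] and -1 at
   [r], hence -1 at [s]. *)
have [H [sHG iH Hsr nHr]] 
  := dihedral_half_subgroup n_gt0 (dihedral_shift n_gt0 dihG) n_even.
have [i lin_i iE] := index2_lin_char sHG iH.
have ir : ('chi_i r = -1)%R by rewrite iE // nHr.
exists i; split=> //; apply: (mulIf (_ : -1 != 0 :> algC)%R); first by rewrite oppr_eq0 oner_eq0.
by rewrite -{1}ir -lin_charM // iE ?Hsr ?groupM // expr0 expr1 mulrNN mulr1.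
Qed.

Let mu b := mu_Iirr G r s n b.

Lemma mu_spec b : [/\ 'chi_(mu b) \is a linear_char,
    forall k, 'chi_(mu b) (r ^+ k)%g = (-1) ^+ k
  & forall k, 'chi_(mu b) (s * r ^+ k)%g = (-1) ^+ b * (-1) ^+ k]%R.
Proof.
have [Gr Gs] := dihedral_inG dihG.
have valE (i : Iirr G) : ('chi_i \is a linear_char)%R -> ('chi_i r = -1)%R ->
    ('chi_i s = (-1) ^+ b)%R ->
  (forall k, 'chi_i (r ^+ k)%g = (-1) ^+ k)%R /\
  (forall k, 'chi_i (s * r ^+ k)%g = (-1) ^+ b * (-1) ^+ k)%R.
  move=> lin_i ir is'; split=> k; rewrite ?lin_charM ?groupX // lin_charX // ir ?is' //.
rewrite /mu /mu_Iirr; case: pickP => [i /andP[lin_i /forallP iE] | no_i] /=.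
  (* The exponents tested in [mu_Iirr] are below [n], so 1 must be among them to read off the value
     at [r]. *)
  have n_gt1 : 1 < n by case: n n_gt0 n_even => [|[]].
  have [] := valE i lin_i; [| | by split].
    by have /andP[/eqP] := iE (Ordinal n_gt1).
  by have /andP[_ /eqP] := iE (Ordinal n_gt0); rewrite /= mulg1 mulr1.
(* Existence shows that the default value of the choice is never reached. *)
have [i [lin_i ir is']] := mu_exists b; have [iR isR] := valE i lin_i ir is'.
have /negP[] := negbT (no_i i); rewrite lin_i /=.
by apply/forallP=> k; rewrite iR isR !eqxx.
Qed.

Lemma mu_lin b : ('chi_(mu b) \is a linear_char)%R.
Proof. by case: (mu_spec b). Qed.

Lemma mu_rotation x b c : x \in R -> ('chi_(mu b) x = 'chi_(mu c) x)%R.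
Proof.
by case/cycleP=> k ->; have [_ -> _] := mu_spec b; have [_ -> _] := mu_spec c.
Qed.

Lemma mu_sQ x b : x \in s *: Q -> ('chi_(mu b) x = (-1) ^+ b)%R.
Proof.
case/lcosetP=> _ /cycleP[k ->] ->; have [_ _ muE] := mu_spec b.
by rewrite -expgM muE exprM sqrrN expr1n expr1n mulr1.
Qed.

Lemma mu_srQ x b : x \in (s * r) *: Q -> ('chi_(mu b) x = - (-1) ^+ b)%R.
Proof.
case/lcosetP=> _ /cycleP[k ->] ->; have [_ _ muE] := mu_spec b.
by rewrite -expgM -mulgA -expgS muE exprS exprM sqrrN !expr1n mulr1 mulrN1.
Qed.

Lemma mu_neq : mu false != mu true.
Proof.
have sQs : s \in s *: Q by apply: lcoset_refl.
apply/eqP=> eq_mu; have := mu_sQ true sQs; rewrite -eq_mu mu_sQ // expr0 expr1.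
by move/eqP; rewrite -addr_eq0 -mulr2n Num.Theory.pnatr_eq0.
Qed.

(** The character mu_0 is 1 on the first coset and -1 on the second. *)
Lemma reflection_halves_disjoint : [disjoint s *: Q & (s * r) *: Q].
Proof.
apply/pred0P=> x /=; apply/andP=> [[/(mu_sQ false) mu_x /(mu_srQ false)]]; rewrite mu_x.
by move/eqP; rewrite expr0 -addr_eq0 -mulr2n Num.Theory.pnatr_eq0.
Qed.

Lemma mu_reflections x : x \in G :\: R -> ('chi_(mu true) x = - 'chi_(mu false) x)%R.
Proof.
rewrite -(dihedral_reflections n_gt0 dihG) -reflections_split.
by case/setUP=> [Hx | Hx]; [rewrite !(mu_sQ _ Hx) | rewrite !(mu_srQ _ Hx)]; rewrite expr1 expr0.
Qed.

End LinearCharacters.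

(** * The map [psi], which splits the reflections *)

Section Psi.

Variables (gT : finGroupType) (G : {group gT}) (r s : gT) (n : nat).
Hypotheses (n_gt0 : (0 < n)%N) (dihG : is_dihedral G r s n) (n_even : ~~ odd n).

Let R := <[r]>%G.
Let Q := <[r ^+ 2]>%G.
Let mu b := mu_Iirr G r s n b.
Let defGR : s *: R = G :\: R. Proof. exact: dihedral_reflections n_gt0 dihG. Qed.
Let defsR : (s *: Q) :|: ((s * r) *: Q) = s *: R. Proof. exact: reflections_split. Qed.
Let neq_mu : mu false != mu true. Proof. exact: mu_neq. Qed.
Let GRs : s \in G :\: R. Proof. by rewrite -defGR lcoset_refl. Qed.
Let GRsr : s * r \in G :\: R. Proof. by rewrite -defGR mem_lcoset mulKg cycle_id. Qed.

Lemma sctQ_E T : (T \in sctQ G r s n) =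
  [&& is_sct T, s *: R \in T.1 & [set mu false; mu true] \in T.2].
Proof. by rewrite inE (sctP_E n_gt0 dihG) expg1 -defGR -andbA. Qed.

Lemma sigma_char_mu b x : sigma_char [set mu b] x = ('chi_(mu b) x)%R.
Proof.
by rewrite sigma_charE big_set1 (lin_char1 (mu_lin n_gt0 dihG n_even b)) mul1r.
Qed.

Lemma sigma_char_mu2 x :
  sigma_char [set mu false; mu true] x = ('chi_(mu false) x + 'chi_(mu true) x)%R.
Proof.
rewrite sigma_charE big_setU1 ?inE //= big_set1.
by rewrite !(lin_char1 (mu_lin n_gt0 dihG n_even _)) !mul1r.
Qed.

Section PsiOf.

Variable T : sct_pair G.
Hypothesis QT : T \in sctQ G r s n.

Lemma psi_sct : is_sct (psi r s n T).
Proof.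
move: QT; rewrite sctQ_E => /and3P[/is_sctP[partK clK partX cardKX K1 sigK] TsR Tmu].
have nz z : z *: Q != set0 by apply/set0Pn; exists z; apply: lcoset_refl.
have tiK := reflection_halves_disjoint n_gt0 dihG n_even.
have TsR' : (s *: Q) :|: ((s * r) *: Q) \in T.1 by rewrite defsR.
have [partK' cardK'] := partition_split partK TsR' (nz s) (nz (s * r)) tiK.
have tiX : [disjoint [set mu false] & [set mu true]].
  by rewrite disjoints1 inE.
have nzX i : [set i] != set0 :> {set Iirr G} by apply/set0Pn; exists i; rewrite inE.
have [partX' cardX'] := partition_split partX Tmu (nzX _) (nzX _) tiX.
rewrite defsR in partK' cardK'.
have subR K : K \in T.1 :\ (s *: R) -> {subset K <= R}.
  case/setD1P=> neqK TK x Kx; have Gx := subsetP (partition_block_sub partK TK) x Kx.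
  apply: contraNT neqK => nRx; apply/eqP.
  by apply: (partition_block_eq partK TK TsR Kx); rewrite defGR inE nRx.
have mu_half K b : K \in [set s *: Q; (s * r) *: Q] ->
    {in K &, forall x y, 'chi_(mu b) x = 'chi_(mu b) y}%R.
  move=> HK x y; case/set2P: HK => -> Hx Hy.
    by rewrite !(mu_sQ n_gt0 dihG n_even b).
  by rewrite !(mu_srQ n_gt0 dihG n_even b).
apply/is_sctP; split=> //=.
- move=> K /setUP[/setD1P[_ /clK] // | /set2P[]->] x Hx.
    have GRx : x \in G :\: R by rewrite -defGR -defsR inE Hx.
    by rewrite (dihedral_class n_gt0 dihG GRx) (lcoset_eqP Hx).
  have GRx : x \in G :\: R by rewrite -defGR -defsR inE Hx orbT.
  by rewrite (dihedral_class n_gt0 dihG GRx) (lcoset_eqP Hx).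
- by rewrite cardK' cardX' cardKX.
- rewrite !inE K1 andbT orbC; apply/orP; right; apply: contraTneq GRs => sR1.
  have: s \in s *: R by apply: lcoset_refl.
  by rewrite -sR1 => /set1P->; rewrite inE group1.
move=> X /setUP[/setD1P[neqX TX] | /set2P Xmu] K K' x y Kx Ky.
  case/setUP: K' => [/setD1P[_ TK] | K']; first exact: (sigK X TX K).
  (* Each new superclass is contained in [s *: R], where the old supercharacters are already
     constant. *)
  have sKsR : {subset K <= s *: R}.
    by move=> z Kz; rewrite -defsR; case/set2P: K' Kz => -> Hz; rewrite inE Hz ?orbT.
  by apply: (sigK X TX _ TsR); apply: sKsR.
have [b ->] : exists b, X = [set mu b] by case: Xmu => ->; [exists false | exists true].
rewrite !sigma_char_mu; case/setUP: K' => [K' | K']; last exact: mu_half Kx Ky.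
have Rx := subR K K' x Kx; have Ry := subR K K' y Ky.
(* On rotations mu_0 and mu_1 agree, so twice either one is the old supercharacter mu_0 + mu_1. *)
have := sigK _ Tmu K (subsetP (subsetDl _ _) K K') x y Kx Ky; rewrite !sigma_char_mu2.
have murot := mu_rotation n_gt0 dihG n_even.
rewrite (murot x false b) // (murot x true b) // (murot y false b) // (murot y true b) //.
by rewrite -!mulr2n; apply: Num.Theory.pmulrnI.
Qed.

Lemma psi_halves : s *: Q \in (psi r s n T).1 /\ (s * r) *: Q \in (psi r s n T).1.
Proof. by split; apply/setUP; right; rewrite ?set21 ?set22. Qed.

Lemma psi_pblock x : x \in G :\: R -> pblock (psi r s n T).1 x = x *: Q.
Proof.
have [sQ srQ] := psi_halves; case/is_sctP: psi_sct => partK _ _ _ _ _.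
rewrite -defGR -defsR => /setUP[]Hx.
  by rewrite (pblock_partition_eq partK sQ Hx) (lcoset_eqP Hx).
by rewrite (pblock_partition_eq partK srQ Hx) (lcoset_eqP Hx).
Qed.

(** For [n] other than 2, automorphisms preserve [R] and [Q], hence permute the cosets of [Q] formed
    by reflections. For [n = 2], [Q] is trivial and all superclasses are singletons. *)
Lemma psi_CharSCT : psi r s n T \in CharSCT G.
Proof.
apply/CharSCTP; split=> [|a AutGa]; first exact: psi_sct.
case/is_sctP: (psi_sct) => partK _ _ _ K1 _.
have [n2 | n2] := eqVneq n 2; last first.
  apply: (dihedral_aut_blocks n_gt0 dihG psi_sct AutGa n2 (subxx R)) => x y GRx Gy.
  have aR := dihedral_aut_mem n_gt0 dihG _ AutGa n2.
  have GRax : a x \in G :\: R.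
    by move: GRx; rewrite !inE (aut_group_mem AutGa) (aR R).
  rewrite !psi_pblock // !mem_lcoset; case/setDP: GRx => Gx _.
  by rewrite -(autV AutGa) // -(autM AutGa) ?groupV // (aR Q) // cycleX.
have Q1 : Q = 1%G by apply/val_inj; rewrite /= -n2; case: dihG => _ _ -> _ _; rewrite cycle1.
have discrete : {in G &, forall x y, (y \in pblock (psi r s n T).1 x) = (y == x)}.
  move=> x y Gx Gy; have [Rx | nRx] := boolP (x \in R); last first.
    by rewrite psi_pblock ?inE ?nRx // Q1 mem_lcoset inE -eq_mulVg1 eq_sym.
  have [Ry | nRy] := boolP (y \in R); last first.
    rewrite (pblock_sym partK) // psi_pblock ?inE ?nRy // Q1 mem_lcoset inE.
    by rewrite -eq_mulVg1.
  have [-> | nyx] := eqVneq y x; first by case: (pblock_partition partK Gx).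
  have [x1 | nx1] := eqVneq x 1.
    by rewrite (pblock_partition_eq partK K1) ?x1 ?set11 // inE -x1 (negPf nyx).
  have [y1 | ny1] := eqVneq y 1.
    rewrite (pblock_sym partK) // (pblock_partition_eq partK K1) ?y1 ?set11 //.
    by rewrite inE (negPf nx1).
  have R2 : R = [set 1; r] :> {set gT} by rewrite /= cycle2g ?(dihedral_order n_gt0 dihG).
  move: nyx; move: Rx Ry; rewrite R2 !inE (negPf nx1) (negPf ny1) /=.
  by move=> /eqP-> /eqP->; rewrite eqxx.
apply: (aut_act_id AutGa psi_sct) => x y Gx Gy.
by rewrite !discrete ?(aut_group_mem AutGa) // (inj_eq perm_inj).
Qed.

(** A member of P_d has all reflections in one superclass, whereas [psi] separates [s] from
    [s * r]. *)
Lemma psi_notin_sctP d : psi r s n T \notin sctP G r d.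
Proof.
rewrite (sctP_E n_gt0 dihG) psi_sct /=; apply/negP=> SGN.
case/is_sctP: (psi_sct) => partK _ _ _ _ _; have [sQ _] := psi_halves.
have GN x : x \in G :\: R -> x \in G :\: <[r ^+ d]>.
  by case/setDP=> Gx; rewrite inE Gx andbT; apply: contra; apply: subsetP (cycleX r d) x.
have /setP/(_ (s * r)) := partition_block_eq partK SGN sQ (GN s GRs) (lcoset_refl _ _).
rewrite GN // => sQsr; have /pred0P/(_ (s * r)) := reflection_halves_disjoint n_gt0 dihG n_even.
by rewrite /= -sQsr lcoset_refl.
Qed.

End PsiOf.

End Psi.

(** * The superclass containing [s] *)

Section Converse.

Variables (gT : finGroupType) (G : {group gT}) (r s : gT) (n : nat).
Hypotheses (n_gt0 : (0 < n)%N) (dihG : is_dihedral G r s n).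

Let R := <[r]>%G.
Let Q := <[r ^+ 2]>%G.
Let defGR : s *: R = G :\: R. Proof. exact: dihedral_reflections n_gt0 dihG. Qed.
Let defsR : (s *: Q) :|: ((s * r) *: Q) = s *: R. Proof. exact: reflections_split. Qed.
Let GRs : s \in G :\: R. Proof. by rewrite -defGR lcoset_refl. Qed.
Let GRsr : s * r \in G :\: R. Proof. by rewrite -defGR mem_lcoset mulKg cycle_id. Qed.

Section Superclass.

Variables (S : sct_pair G) (K : {set gT}).
Hypotheses (sctS : is_sct S) (SK : K \in S.1).

Lemma reflection_coset_sub x : x \in G :\: R -> x \in K -> x *: Q \subset K.
Proof.
move=> GRx Kx; case/is_sctP: sctS => _ clK _ _ _ _.
by rewrite -(dihedral_class n_gt0 dihG GRx) clK.
Qed.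

(** Every element is conjugate to its inverse: [s] inverts rotations, and reflections are their own
    inverses. *)
Lemma superclass_inv x : x \in K -> x^-1 \in K.
Proof.
move=> Kx; have /andP[sKG /subsetP nKG] := sct_block_normal sctS SK.
have Gx := subsetP sKG x Kx; have [_ Gs] := dihedral_inG dihG.
have [Rx | nRx] := boolP (x \in R).
  by rewrite -(dihedral_conj_s dihG Rx) memJ_norm // nKG.
by rewrite (dihedral_invol n_gt0 dihG) // inE nRx.
Qed.

(** As [K] is closed under inverses, the count is the value at [y] of the convolution square of the
    indicator of [K], which is again a superclass function. *)
Lemma card_superclass_shift y z : y \in K -> z \in K ->
  #|[set x in K | x * y \in K]| = #|[set x in K | x * z \in K]|.
Proof.
have nsKG := sct_block_normal sctS SK.
have sumE y0 : (\sum_(x in G) ('1_K : 'CF(G)) (x * y0)%g * ('1_K : 'CF(G)) x^-1%g)%R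
    = (#|[set x in K | (x * y0)%g \in K]|%:R)%R.
  rewrite -sum1_card natr_sum; transitivity (\sum_(x in G | (x \in K) && ((x * y0)%g \in K)) 1%R : algC)%R.
    rewrite big_mkcondr; apply: eq_bigr => x Gx; rewrite !cfuniE //.
    have -> : (x^-1 \in K) = (x \in K).
      by apply/idP/idP=> /superclass_inv; rewrite ?invgK.
    by case: (x \in K); case: (_ \in K); rewrite ?mulr1 ?mulr0.
  apply: eq_big => [x | //]; rewrite inE; case Kx: (x \in K); rewrite ?andbF //.
  by rewrite (subsetP (normal_sub nsKG)).
have fK := cfuni_block sctS SK.
move=> Ky Kz; have := block_fun_convolution sctS fK fK SK Ky Kz.
by rewrite !sumE => /eqP; rewrite Num.Theory.eqr_nat => /eqP.
Qed.

Hypotheses (Ks : s \in K) (Ksr : s * r \in K).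

Let sGRK : G :\: R \subset K.
Proof.
by rewrite -defGR -defsR subUset !reflection_coset_sub.
Qed.

(* Comparing the coefficients at s and at a of the square of the class sum of K:
   2|A| = n + |A :&: A a^-1| for A = K :&: R, so that A and A a^-1 cover R. *)
Lemma superclass_rotation_cover a b :
  a \in K :&: R -> b \in R -> (b \in K) || (b * a \in K).
Proof.
move=> /setIP[Ka Ra] Rb; pose A := K :&: R.
have sKG := normal_sub (sct_block_normal sctS SK).
have [_ Gs] := dihedral_inG dihG; have Ga := subsetP sKG a Ka.
have mulR := dihedral_mul_reflections n_gt0 dihG.
have KE x : x \in G -> x \notin R -> x \in K.
  by move=> Gx nRx; apply: (subsetP sGRK); rewrite inE nRx.
have cR : #|G :\: R| = n by rewrite -defGR card_lcoset -orderE (dihedral_order n_gt0 dihG).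
have ns := dihedral_s_notin n_gt0 dihG.
(* Exactly one of [x] and [x * s] is a rotation, and all reflections are in [K], so only that
   rotation has to be tested. *)
have cs : #|[set x in K | x * s \in K]| = (#|A| + #|A|)%N.
  have -> : [set x in K | x * s \in K] = A :|: A :* s.
    apply/setP=> x; rewrite in_setU mem_rcoset (dihedral_sV dihG) !inE.
    have [Gx | nGx] := boolP (x \in G); last first.
      have nKx : x \notin K by apply: contra nGx; apply: (subsetP sKG).
      rewrite (negPf nKx) /=; apply/esym/negP=> /andP[_ Rxs]; case/negP: nGx.
      by rewrite -(groupMr _ Gs) (subsetP (dihedral_sRG dihG)).
    have [Rx | nRx] := boolP (x \in R).
      have nRxs : x * s \notin R by rewrite groupMl.
      by rewrite (negPf nRxs) !andbF orbF (KE _ (groupM Gx Gs) nRxs).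
    have GRx : x \in G :\: R by rewrite inE nRx.
    by rewrite (KE x) // andbF /= mulR // ns andbT.
  rewrite cardsU card_rcoset; suffices -> : A :&: A :* s = set0 by rewrite cards0 subn0.
  apply/setP=> x; rewrite !inE mem_rcoset (dihedral_sV dihG) !inE.
  have [Rx | _] := boolP (x \in R); last by rewrite andbF.
  by rewrite [x * s \in R]groupMl // (negPf ns) !andbF.
(* Multiplication by the rotation [a] keeps reflections and rotations apart: all [n] reflections
   count, and a rotation counts when [x] and [x * a] are both in [A]. *)
have ca : #|[set x in K | x * a \in K]| = (n + #|A :&: (A :* a^-1)|)%N.
  have -> : [set x in K | x * a \in K] = (G :\: R) :|: (A :&: (A :* a^-1)).
    apply/setP=> x; rewrite in_setU in_setI mem_rcoset invgK !inE.
    have [Rx | nRx] := boolP (x \in R).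
      by rewrite groupM // !andbT.
    rewrite andbF orbF /=; have [Gx | nGx] := boolP (x \in G); last first.
      by rewrite (contraNF (subsetP sKG x) nGx).
    by rewrite (KE _ Gx nRx) (KE (x * a)) ?groupMr // groupM.
  rewrite cardsU cR; suffices -> : (G :\: R) :&: (A :&: (A :* a^-1)) = set0.
    by rewrite cards0 subn0.
  by apply/setP=> x; rewrite !inE; case: (x \in R); rewrite ?andbF.
have cardA : #|A :|: A :* a^-1| = n.
  apply/eqP; rewrite -(eqn_add2r #|A :&: (A :* a^-1)|) cardsUI card_rcoset.
  by rewrite -cs -ca (card_superclass_shift Ks Ka).
have AR : A :|: A :* a^-1 = R.
  apply/eqP; rewrite eqEcard cardA -orderE (dihedral_order n_gt0 dihG) leqnn andbT.
  rewrite subUset subsetIr; apply/subsetP=> x; rewrite mem_rcoset invgK => /setIP[_].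
  by rewrite groupMr.
move: Rb; rewrite -AR in_setU mem_rcoset invgK => /orP[]/setIP[-> //].
by rewrite orbT.
Qed.

Lemma superclass_of_all_reflections :
  exists2 d, d \in divisors n & K = G :\: <[r ^+ d]>.
Proof.
case/is_sctP: (sctS) => partK _ _ _ S1 _.
have gB : group_set (R :\: K).
  apply/group_setP; split=> [|x y /setDP[Rx nKx] /setDP[Ry nKy]].
    rewrite inE group1 andbT; apply/negP=> K1.
    have := dihedral_s_notin n_gt0 dihG.
    move: Ks; rewrite (partition_block_eq partK SK S1 K1 (set11 _)) => /set1P->.
    by rewrite group1.
  rewrite inE groupM // andbT; apply/negP=> Kxy.
  (* With [a = x * y] and [b = x^-1] one has [b * a = y]: if [x * y] were in [K], so would be [x^-1]
     or [y]. *)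
  have := @superclass_rotation_cover (x * y) x^-1.
  rewrite inE Kxy groupM ?groupV // mulKg (negPf nKy) orbF => /(_ isT Rx).
  by move/superclass_inv; rewrite invgK (negPf nKx).
pose B := Group gB; have sBR : B \subset R by apply: subsetDl.
have dvdB : #|B| %| #[r] by rewrite cardSg.
(* A cyclic group has one subgroup of each order dividing its own, which yields the exponent
   [d = n %/ #|B|]. *)
have : B \in [set H : {group gT} | H \subset <[r]> & #|H| == #|B|] by rewrite inE sBR eqxx.
rewrite (cycle_sub_group dvdB) => /set1P/(congr1 val)/= defB.
exists (n %/ #|B|).
  by rewrite -dvdn_divisors // -(dihedral_order n_gt0 dihG) dvdn_div.
rewrite -{1}(dihedral_order n_gt0 dihG) -defB; apply/setP=> x; rewrite !inE.
have [Kx | nKx] := boolP (x \in K).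
  by rewrite (subsetP (normal_sub (sct_block_normal sctS SK))).
apply/esym/negP=> /andP[nRx Gx]; case/negP: nKx; apply: (subsetP sGRK).
by rewrite inE nRx.
Qed.

End Superclass.

Lemma shift_automorphism :
  exists2 a, a \in Aut G & {in R, a =1 id} /\ {in G :\: R, forall x, a x = x * r}.
Proof.
have [Gr _] := dihedral_inG dihG.
pose f x := if x \in G :\: R then x * r else x.
have fGR x : (f x \in G :\: R) = (x \in G :\: R).
  rewrite /f; case: ifP => // /setDP[Gx nRx].
  by rewrite inE groupMr ?cycle_id // nRx groupM.
have injf : injective f.
  move=> x y eq_f; have := fGR y; rewrite -eq_f fGR; move: eq_f; rewrite /f => eq_f eqGR.
  by move: eq_f; rewrite -eqGR; case: ifP => // _ /mulIg.
have fE x : x \in G -> f x = if x \in R then x else x * r.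
  by move=> Gx; rewrite /f inE Gx andbT; case: (x \in R).
exists (perm injf); last first.
  split=> x; first by move=> Rx; rewrite permE /f inE Rx.
  by move=> GRx; rewrite permE /f GRx.
rewrite inE; apply/andP; split.
  by apply/subsetP=> x; rewrite inE permE /f; case: ifP => [/setDP[] //|]; rewrite eqxx.
apply/morphicP=> x y Gx Gy; rewrite !permE (fE _ (groupM Gx Gy)) !fE //.
have cRR : abelian R := cycle_abelian r.
have [Rx | nRx] := boolP (x \in R).
  by rewrite groupMl //; case: ifP; rewrite ?mulgA.
have GRx : x \in G :\: R by rewrite inE nRx.
rewrite (dihedral_mul_reflections n_gt0 dihG GRx Gy).
have [Ry | nRy] := boolP (y \in R) => /=.
  by rewrite -!mulgA (centsP cRR r (cycle_id r) y).
have GRy : y \in G :\: R by rewrite inE nRy.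
(* For two reflections the image product is [x * r * y * r], and [r * y * r = y] because [y] inverts
   [r]. *)
rewrite -mulgA; congr (x * _).
have := dihedral_conj n_gt0 dihG (cycle_id r) GRy.
rewrite conjgE (dihedral_invol n_gt0 dihG GRy) => yry.
apply: (mulgI y); rewrite [r * _]mulgA [RHS]mulgA yry mulVg.
by rewrite -{1}(dihedral_invol n_gt0 dihG GRy) mulVg.
Qed.

Lemma characteristic_reflection_halves S K : S \in CharSCT G -> K \in S.1 ->
    s \in K -> s * r \notin K ->
  [/\ ~~ odd n, s *: Q \in S.1 & (s * r) *: Q \in S.1].
Proof.
case/CharSCTP=> sctS charS SK Ks nKsr.
case/is_sctP: (sctS) => partK _ _ _ _ _.
have sQK : s *: Q \subset K by apply: reflection_coset_sub sctS SK _ GRs Ks.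
have n_even : ~~ odd n.
  apply: contra nKsr => n_odd; apply: (subsetP sQK).
  (* For odd [n], [r = r ^+ n.+1] is an even power, so [s * r] lies in [s *: Q]. *)
  rewrite mem_lcoset mulKg; apply/cycleP; exists n.+1./2.
  have -> : r ^+ 2 ^+ n.+1./2 = r ^+ n.+1.
    by rewrite -expgM mul2n -{2}(odd_double_half n.+1) /= n_odd.
  by rewrite expgS; case: dihG => _ _ -> _ _; rewrite mulg1.
have [a AutGa [aR aGR]] := shift_automorphism.
have SaK : a @: K \in S.1.
  have := charS a AutGa; rewrite /aut_act /superclasses => /(congr1 fst)/= <-.
  exact: imset_f.
have aKsr : s * r \in a @: K by rewrite -aGR ?imset_f.
have sKG := subsetP (partition_block_sub partK SK).
(* A rotation in [K] is fixed by [a], so [K] would meet its image and equal it, and thus contain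
   [s * r]. *)
have nKR x : x \in K -> x \notin R.
  move=> Kx; apply: contra nKsr => Rx.
  have aKx : x \in a @: K by rewrite -(aR x Rx) imset_f.
  by rewrite (partition_block_eq partK SK SaK Kx aKx).
have defK : K = s *: Q.
  apply/eqP; rewrite eqEsubset sQK andbT; apply/subsetP=> x Kx.
  have : x \in s *: R by rewrite defGR inE nKR ?sKG.
  rewrite -defsR => /setUP[// | srQx]; case/negP: nKsr.
  have GRx : x \in G :\: R by rewrite inE nKR ?sKG.
  apply: (subsetP (reflection_coset_sub sctS SK GRx Kx)).
  by rewrite (lcoset_eqP srQx) lcoset_refl.
split=> //; first by rewrite -defK.
suffices <- : a @: K = (s * r) *: Q by [].
apply/eqP; rewrite eqEsubset (reflection_coset_sub sctS SaK) // andbT.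
apply/subsetP=> _ /imsetP[x Kx ->]; rewrite aGR; last by rewrite inE nKR ?sKG.
move: Kx; rewrite defK => /lcosetP[z Qz ->]; rewrite mem_lcoset invMg -!mulgA mulKg.
have cRR : abelian R := cycle_abelian r.
by rewrite (centsP cRR z _ r (cycle_id r)) ?mulKg // (subsetP (cycleX r 2)).
Qed.

End Converse.

(** * Merging the two classes of reflections: a preimage under [psi] *)

Section MergedTheory.

Variables (gT : finGroupType) (G : {group gT}) (r s : gT) (n : nat).
Hypotheses (n_gt0 : (0 < n)%N) (dihG : is_dihedral G r s n) (n_even : ~~ odd n).

Let R := <[r]>%G.
Let Q := <[r ^+ 2]>%G.
Let mu b := mu_Iirr G r s n b.
Let defGR : s *: R = G :\: R. Proof. exact: dihedral_reflections n_gt0 dihG. Qed.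
Let defsR : (s *: Q) :|: ((s * r) *: Q) = s *: R. Proof. exact: reflections_split. Qed.
Let neq_mu : mu false != mu true. Proof. exact: mu_neq. Qed.

Variable S : sct_pair G.
Hypotheses (sctS : is_sct S) (SsQ : s *: Q \in S.1) (SsrQ : (s * r) *: Q \in S.1).

Let partK : partition S.1 G. Proof. by case/is_sctP: sctS. Qed.
Let partX : partition S.2 [set: Iirr G]. Proof. by case/is_sctP: sctS. Qed.

Lemma superclass_rotations K : K \in S.1 ->
  [\/ K = s *: Q, K = (s * r) *: Q | {subset K <= R}].
Proof.
move=> SK; have [-> | neqK] := eqVneq K (s *: Q); first by constructor 1.
have [-> | neqK'] := eqVneq K ((s * r) *: Q); first by constructor 2.
constructor 3 => x Kx; have Gx := subsetP (partition_block_sub partK SK) x Kx.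
have [// | nRx] := boolP (x \in R).
have: x \in s *: R by rewrite defGR inE nRx.
rewrite -defsR => /setUP[]Hx.
  by rewrite (partition_block_eq partK SK SsQ Kx Hx) eqxx in neqK.
by rewrite (partition_block_eq partK SK SsrQ Kx Hx) eqxx in neqK'.
Qed.

(** The difference vanishes on rotations and is constant on each of the two classes of
    reflections. *)
Lemma block_fun_mu_diff b : block_fun S ('chi_(mu b) - 'chi_(mu (~~ b)))%R.
Proof.
move=> K SK x y Kx Ky; rewrite !cfunE.
case: (superclass_rotations SK) => [defK | defK | KR].
- by move: Kx Ky; rewrite defK => Hx Hy; rewrite !(mu_sQ n_gt0 dihG n_even).
- by move: Kx Ky; rewrite defK => Hx Hy; rewrite !(mu_srQ n_gt0 dihG n_even).
have murot := mu_rotation n_gt0 dihG n_even.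
by rewrite (murot x b (~~ b)) ?KR // (murot y b (~~ b)) ?KR // !subrr.
Qed.

(** Apply [block_fun_ratio] to the difference of the two characters: at [mu b] the ratio is 1, while
    any other irreducible character has coefficient 0 or -1, never its positive degree. *)
Lemma mu_parts b : [set mu b] \in S.2.
Proof.
have [SX Xb] := pblock_partition partX (in_setT (mu b)).
suffices defX : pblock S.2 (mu b) = [set mu b] by rewrite -defX.
apply/eqP; rewrite eqEsubset sub1set Xb andbT; apply/subsetP=> j Xj.
have neq_mub : mu (~~ b) != mu b by case: (b) => //=; rewrite eq_sym.
have := block_fun_ratio sctS (block_fun_mu_diff b) SX Xb Xj.
rewrite !cfdotBl !cfdot_irr eqxx (negPf neq_mub) subr0 mul1r.
rewrite (lin_char1 (mu_lin n_gt0 dihG n_even b)) mulr1 inE eq_sym.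
case: eqP => // _; rewrite sub0r => chi_j1; have := irr1_gt0 j.
by rewrite chi_j1 Num.Theory.oppr_gt0 Num.Theory.ltrn0.
Qed.

(** Here [sigma_char X] is orthogonal to mu_0 - mu_1, which is 0 on rotations, 2 on [s *: Q] and -2
    on the other coset. The scalar product is therefore a nonzero multiple of the difference of the
    two values. *)
Lemma sigma_char_reflections X : X \in S.2 -> mu false \notin X -> mu true \notin X ->
  sigma_char X s = sigma_char X (s * r).
Proof.
move=> SX nXf nXt; case/is_sctP: (sctS) => _ _ _ _ _ /(_ X SX) sigK.
have sQG : s *: Q \subset G by apply: partition_block_sub partK SsQ.
have srQG : (s * r) *: Q \subset G by apply: partition_block_sub partK SsrQ.
pose f : 'CF(G) := ('chi_(mu false) - 'chi_(mu true))%R.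
have : ('[sigma_char X, f] = 0)%R.
  by rewrite cfdotBr !cfdot_sigma (negPf nXf) (negPf nXt) !mul0r subrr.
move/(congr1 (fun z => #|G|%:R * z))%R; rewrite mulr0 mulVKf ?neq0CG //.
rewrite (bigID [in R]) /= big1 ?add0r => [|x /andP[_ Rx]]; last first.
  by rewrite !cfunE (mu_rotation n_gt0 dihG n_even false true Rx) subrr rmorph0 mulr0.
rewrite (eq_bigl [in s *: R]); last by move=> x; rewrite defGR inE andbC.
rewrite (big_setID (s *: Q)) /=.
have -> : s *: R :&: s *: Q = s *: Q by apply/setIidPr; rewrite -defsR subsetUl.
have -> : s *: R :\: s *: Q = (s * r) *: Q.
  rewrite -defsR setDUl setDv set0U; apply/setDidPl; rewrite disjoint_sym.
  exact: reflection_halves_disjoint n_gt0 dihG n_even.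
have sumE z c : z *: Q \in S.1 -> {in z *: Q, forall x, f x = c} ->
    (\sum_(x in (z *: Q)%g) sigma_char X x * (f x)^* = sigma_char X z * c^* *+ #|Q|)%R.
  move=> SzQ fc; rewrite -(card_lcoset Q z) -sumr_const; apply: eq_bigr => x Hx.
  by rewrite fc // (sigK _ SzQ x z) // lcoset_refl.
rewrite (sumE s 2%:R%R) ?(sumE (s * r) (- 2%:R)%R) //; last 2 first.
- by move=> x Hx; rewrite !cfunE !(mu_srQ n_gt0 dihG n_even _ Hx) expr0 expr1 opprK -opprD.
- by move=> x Hx; rewrite !cfunE !(mu_sQ n_gt0 dihG n_even _ Hx) expr0 expr1 opprK.
rewrite rmorphN !rmorph_nat mulrN mulNrn => /eqP.
rewrite subr_eq0 -!mulrnAr => /eqP; apply: mulIf.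
by rewrite -mulrnA Num.Theory.pnatr_eq0 muln_eq0 /= -lt0n cardG_gt0.
Qed.

Let U := (s *: Q) :|: ((s * r) *: Q).
Let V := [set mu false] :|: [set mu true].

Definition merge_reflections : sct_pair G :=
  (U |: S.1 :\: [set s *: Q; (s * r) *: Q],
   V |: S.2 :\: [set [set mu false]; [set mu true]]).

Let neq_halves : s *: Q != (s * r) *: Q.
Proof.
apply/eqP=> eqQ; have /pred0P/(_ s) := reflection_halves_disjoint n_gt0 dihG n_even.
by rewrite /= -eqQ lcoset_refl.
Qed.

Let neq_mu_parts : [set mu false] != [set mu true].
Proof. by rewrite (inj_eq set1_inj). Qed.

Lemma merge_sct : is_sct merge_reflections.
Proof.
case/is_sctP: (sctS) => _ clK _ cardKX K1 sigK.
have [partK' cardK'] := partition_merge partK SsQ SsrQ neq_halves.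
have [partX' cardX'] := partition_merge partX (mu_parts false) (mu_parts true) neq_mu_parts.
apply/is_sctP; split=> //=.
- move=> K /setU1P[-> | /setDP[/clK //]] x; rewrite /U => Ux.
  have GRx : x \in G :\: R by rewrite -defGR -defsR.
  rewrite (dihedral_class n_gt0 dihG GRx).
  by case/setUP: Ux => /lcoset_eqP->; rewrite ?subsetUl ?subsetUr.
- by apply/eqP; rewrite -eqSS -cardK' -cardX' cardKX.
- rewrite !inE K1 andbT; apply/orP; right.
  have ne1 x : x \notin R -> ([set 1] == x *: Q) = false.
    move=> nRx; apply: contraNF nRx => /eqP/setP/(_ x).
    by rewrite lcoset_refl => /set1P->; rewrite group1.
  have nRs : s \notin R := dihedral_s_notin n_gt0 dihG.
  by rewrite !ne1 ?groupMr ?cycle_id.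
have mu_const b K : K \in S.1 -> {in K &, forall x y, 'chi_(mu b) x = 'chi_(mu b) y}%R.
  move=> SK x y Kx Ky; have := sigK _ (mu_parts b) K SK x y Kx Ky.
  by rewrite !(sigma_char_mu n_gt0 dihG n_even).
move=> X HX K HK x y Kx Ky.
have mu_in b : [set mu b] != X -> X \in S.2 -> mu b \notin X.
  move=> neqX SX; apply: contra neqX => Xb.
  by rewrite (partition_block_eq partX (mu_parts b) SX (set11 _) Xb).
case/setU1P: HK Kx Ky => [-> Ux Uy | /setDP[SK _]].
  case/setU1P: HX => [-> | /setDP[SX]].
    (* The merged supercharacter mu_0 + mu_1 vanishes on all reflections. *)
    move: Ux Uy; rewrite /U defsR defGR => GRx GRy; rewrite !(sigma_char_mu2 n_gt0 dihG n_even).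
    by rewrite !(mu_reflections n_gt0 dihG n_even) // !subrr.
  rewrite !inE negb_or ![X == _]eq_sym => /andP[nf nt].
  have sigU z : z \in U -> sigma_char X z = sigma_char X s.
    case/setUP=> Hz; first exact: sigK SX _ SsQ _ _ Hz (lcoset_refl _ _).
    rewrite (sigma_char_reflections SX) ?mu_in //.
    exact: sigK SX _ SsrQ _ _ Hz (lcoset_refl _ _).
  by rewrite !sigU.
move=> Kx Ky; case/setU1P: HX => [-> | /setDP[SX _]]; last exact: sigK SX K SK x y Kx Ky.
rewrite !(sigma_char_mu2 n_gt0 dihG n_even).
by rewrite (mu_const false K SK x y) // (mu_const true K SK x y).
Qed.

Lemma merge_sctQ : merge_reflections \in sctQ G r s n.
Proof.
by rewrite (sctQ_E n_gt0 dihG) merge_sct /= -defsR !setU11.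
Qed.

Lemma psi_merge : psi r s n merge_reflections = S.
Proof.
rewrite /psi /superclasses /superchar_parts /= -defsR.
rewrite (partition_mergeK partK SsQ SsrQ neq_halves).
rewrite (partition_mergeK partX (mu_parts false) (mu_parts true) neq_mu_parts).
by case: S.
Qed.

End MergedTheory.

(** * Assembling the decomposition *)

Section CharacteristicTheories.

Variables (gT : finGroupType) (G : {group gT}) (r s : gT) (n : nat).
Hypotheses (n_gt0 : (0 < n)%N) (dihG : is_dihedral G r s n).

Lemma mem_bigcup_sctP S :
  reflect (exists2 d, d \in divisors n & S \in sctP G r d)
          (S \in \bigcup_(d <- divisors n) sctP G r d).
Proof.
elim: (divisors n) => [|d ds IHds].
  by rewrite big_nil inE; constructor => [[]].
rewrite big_cons in_setU; apply: (iffP orP) => [[Sd | /IHds[e de Se]] | [e]].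
- by exists d; rewrite ?mem_head.
- by exists e; rewrite // inE de orbT.
by rewrite inE => /predU1P[-> | de Se]; [left | right; apply/IHds; exists e].
Qed.

(** The alternative is whether [s * r] lies in the superclass of [s]. *)
Lemma CharSCT_cases S : S \in CharSCT G ->
     S \in \bigcup_(d <- divisors n) sctP G r d
  \/ ~~ odd n /\ exists2 T, T \in sctQ G r s n & S = psi r s n T.
Proof.
move=> charS; have /CharSCTP[sctS _] := charS.
case/is_sctP: (sctS) => partK _ _ _ _ _; have [_ Gs] := dihedral_inG dihG.
have [SK Ks] := pblock_partition partK Gs.
have [Ksr | nKsr] := boolP (s * r \in pblock S.1 s).
  left; apply/mem_bigcup_sctP.
  have [d dvd_d defK] := superclass_of_all_reflections n_gt0 dihG sctS SK Ks Ksr.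
  by exists d; rewrite // (sctP_E n_gt0 dihG) sctS -defK.
right; have [n_even SsQ SsrQ] :=
  characteristic_reflection_halves n_gt0 dihG charS SK Ks nKsr.
split=> //; exists (merge_reflections r s n S); last by rewrite psi_merge.
exact: merge_sctQ.
Qed.

End CharacteristicTheories.

Theorem theorem3p1 (gT : finGroupType) (G : {group gT}) (r s : gT) (n : nat)
    (n_gt0 : (0 < n)%N) (dihG : is_dihedral G r s n) :
  {in divisors n &, forall d e : nat, d != e ->
     [disjoint sctP G r d & sctP G r e]} /\
  (odd n -> CharSCT G = \bigcup_(d <- divisors n) sctP G r d) /\
  (~~ odd n ->
     [/\ forall T, T \in sctQ G r s n -> psi r s n T \in CharSCT G,
         [disjoint \bigcup_(d <- divisors n) sctP G r d
                 & [set psi r s n T | T in sctQ G r s n]]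
       & n != 2 ->
         CharSCT G = (\bigcup_(d <- divisors n) sctP G r d)
                       :|: [set psi r s n T | T in sctQ G r s n]]).
Proof.
have dvd_divisors d : d \in divisors n -> d %| n by rewrite -dvdn_divisors.
split=> [d e /dvd_divisors dvd_d /dvd_divisors dvd_e | ].
  exact: (sctP_disjoint n_gt0 dihG dvd_d dvd_e).
have sctP_char : n != 2 -> \bigcup_(d <- divisors n) sctP G r d \subset CharSCT G.
  move=> n2; apply/subsetP=> S /mem_bigcup_sctP[d _ Sd].
  exact: (sctP_CharSCT n_gt0 dihG n2 Sd).
split=> [n_odd | n_even].
  (* An odd [n] differs from 2, so the theories in the intervals are characteristic. *)
  apply/eqP; rewrite eqEsubset sctP_char ?andbT; last by apply: contraTneq n_odd => ->.
  apply/subsetP=> S /(CharSCT_cases n_gt0 dihG)[// | []]; by rewrite n_odd.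
split=> [T QT | | n2]; first exact: (psi_CharSCT n_gt0 dihG n_even QT).
  rewrite disjoint_sym disjoint_subset; apply/subsetP=> _ /imsetP[T QT ->].
  rewrite inE; apply/mem_bigcup_sctP=> [[d _]]; apply/negP.
  exact: (psi_notin_sctP n_gt0 dihG n_even QT).
apply/eqP; rewrite eqEsubset subUset sctP_char //=; apply/andP; split.
  apply/subsetP=> S /(CharSCT_cases n_gt0 dihG)[PS | [_ [T QT ->]]].
    by rewrite inE PS.
  by rewrite inE imset_f ?orbT.
by apply/subsetP=> _ /imsetP[T QT ->]; apply: (psi_CharSCT n_gt0 dihG n_even QT).
Qed.
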